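(* Let $p$ be a prime, $0<\epsilon<1-\frac1p$, and let $\xi$ be the random variable in $\mathbb{Z}_p$ with $\mathbb{P}(\xi=0)=1-\epsilon$ and $\mathbb{P}(\xi=1)=\epsilon$. For an $n$-tuple $\Sigma_n=(\sigma_{n,1},\ldots,\sigma_{n,n})$ of subsets of $[n]$, let $X_n$ be a Haar-random matrix in $\mathrm{M}_n(\mathbb{Z}_p)$ supported on $\Sigma_n$, and let $Y_n\in\mathrm{M}_n(\mathbb{Z}_p)$ be the random matrix with $(Y_n)_{i,j}=0$ for $i\notin\sigma_{n,j}$ whose entries $(Y_n)_{i,j}$ with $i\in\sigma_{n,j}$ are i.i.d. copies of $\xi$. Then there exists a sequence $(\Sigma_n)_{n\ge1}$ such that $\mathrm{cok}(X_n)$ converges to CL and $\mathrm{cok}(Y_n)$ does not converge to CL.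
   Context: $[n]=\{1,\ldots,n\}$. A Haar-random matrix supported on $\Sigma_n$ has $(X_n)_{i,j}=0$ for $i\notin\sigma_{n,j}$ and independent Haar-distributed entries $(X_n)_{i,j}$ for $i\in\sigma_{n,j}$. A sequence of random matrices $Z_n$ has $\mathrm{cok}(Z_n)$ converging to CL if for every finite abelian $p$-group $H$, $\lim_{n\to\infty}\mathbb{P}(\mathrm{cok}(Z_n)\cong H)=\frac{1}{|\mathrm{Aut}(H)|}\prod_{i=1}^\infty(1-p^{-i})$. *)

(* Defs.v *)
From HB Require Import structures.
From mathcomp Require Import all_boot all_order all_fingroup all_algebra all_solvable.
From mathcomp Require Import all_classical all_reals all_analysis.

Set Implicit Arguments.
Unset Strict Implicit.
Unset Printing Implicit Defensive.

Import Order.TTheory GRing.Theory Num.Theory.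
Import numFieldNormedType.Exports.

Local Open Scope classical_set_scope.
Local Open Scope ring_scope.

(* The inverse limit of the rings Z/p^(k+1), k >= 0.  The level Z/p^0 = 0 is
   left out because the library type 'Z_1 denotes Z/2. *)
Record padic (p : nat) := Padic {
  residue :> forall k : nat, 'Z_(p ^ k.+1);
  residue_compat : forall k, (residue k.+1 : nat)%:R = residue k }.

Lemma padicP p (x y : padic p) : (forall k, x k = y k) -> x = y.
Proof.
case: x y => [x hx] [y hy] /= xy.
have {}xy : x = y by apply: functional_extensionality_dep.
by subst y; congr Padic; exact: Prop_irrelevance.
Qed.

HB.instance Definition _ p := gen_eqMixin (padic p).
HB.instance Definition _ p := gen_choiceMixin (padic p).

Section PadicRing.
Variable p : nat.
Implicit Types x y z : padic p.

Definition reduce k (a : 'Z_(p ^ k.+2)) : 'Z_(p ^ k.+1) := (a : nat)%:R.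

Lemma Zp_modulus_dvd k :
  ((Zp_trunc (p ^ k.+1)).+2 %| (Zp_trunc (p ^ k.+2)).+2)%N.
Proof.
case: p => [|[|q]]; first by rewrite !exp0n.
  by rewrite !exp1n.
have Z j : (Zp_trunc (q.+2 ^ j.+1)).+2 = (q.+2 ^ j.+1)%N.
  by rewrite Zp_cast // (leq_trans _ (leq_pexp2l _ (ltn0Sn j))).
by rewrite !Z dvdn_exp2l.
Qed.

Lemma reduce_nat k m : reduce (m%:R : 'Z_(p ^ k.+2)) = m%:R.
Proof.
apply: val_inj; rewrite /reduce !Zp_nat /= modn_dvdm //.
exact: Zp_modulus_dvd.
Qed.

Lemma reduceD k : {morph @reduce k : a b / a + b}.
Proof.
move=> a b; rewrite -(natr_Zp a) -(natr_Zp b) -natrD !reduce_nat.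
by rewrite natrD.
Qed.

Lemma reduceM k : {morph @reduce k : a b / a * b}.
Proof.
move=> a b; rewrite -(natr_Zp a) -(natr_Zp b) -natrM !reduce_nat.
by rewrite natrM.
Qed.

Lemma reduceN k : {morph @reduce k : a / - a}.
Proof.
move=> a; apply: (addrI (reduce a)); rewrite -reduceD !subrr.
exact: (reduce_nat k 0).
Qed.

Lemma padic0_compat k : reduce (0 : 'Z_(p ^ k.+2)) = 0.
Proof. exact: (reduce_nat k 0). Qed.
Lemma padic1_compat k : reduce (1 : 'Z_(p ^ k.+2)) = 1.
Proof. exact: (reduce_nat k 1). Qed.
Lemma padicN_compat x k : reduce (- x k.+1) = - x k.
Proof. by rewrite reduceN /reduce residue_compat. Qed.
Lemma padicD_compat x y k : reduce (x k.+1 + y k.+1) = x k + y k.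
Proof. by rewrite reduceD /reduce !residue_compat. Qed.
Lemma padicM_compat x y k : reduce (x k.+1 * y k.+1) = x k * y k.
Proof. by rewrite reduceM /reduce !residue_compat. Qed.

Definition padic0 : padic p := @Padic p (fun=> 0) padic0_compat.
Definition padic1 : padic p := @Padic p (fun=> 1) padic1_compat.
Definition padic_opp x : padic p :=
  @Padic p (fun k => - x k) (padicN_compat x).
Definition padic_add x y : padic p :=
  @Padic p (fun k => x k + y k) (padicD_compat x y).
Definition padic_mul x y : padic p :=
  @Padic p (fun k => x k * y k) (padicM_compat x y).

Lemma padic_addA : associative padic_add.
Proof. by move=> x y z; apply: padicP => k /=; rewrite addrA. Qed.
Lemma padic_addC : commutative padic_add.
Proof. by move=> x y; apply: padicP => k /=; rewrite addrC. Qed.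
Lemma padic_add0 : left_id padic0 padic_add.
Proof. by move=> x; apply: padicP => k /=; rewrite add0r. Qed.
Lemma padic_addN : left_inverse padic0 padic_opp padic_add.
Proof. by move=> x; apply: padicP => k /=; rewrite addNr. Qed.

HB.instance Definition _ := GRing.isZmodule.Build (padic p)
  padic_addA padic_addC padic_add0 padic_addN.

Lemma padic_mulA : associative padic_mul.
Proof. by move=> x y z; apply: padicP => k /=; rewrite mulrA. Qed.
Lemma padic_mulC : commutative padic_mul.
Proof. by move=> x y; apply: padicP => k /=; rewrite mulrC. Qed.
Lemma padic_mul1 : left_id padic1 padic_mul.
Proof. by move=> x; apply: padicP => k /=; rewrite mul1r. Qed.
Lemma padic_mulDl : left_distributive padic_mul padic_add.
Proof. by move=> x y z; apply: padicP => k /=; rewrite mulrDl. Qed.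
Lemma padic1_neq0 : padic1 != padic0.
Proof.
by apply/eqP => /(congr1 (fun x : padic p => x 0%N)) /= /eqP; rewrite oner_eq0.
Qed.

HB.instance Definition _ := GRing.Zmodule_isComNzRing.Build (padic p)
  padic_mulA padic_mulC padic_mul1 padic_mulDl padic1_neq0.

HB.instance Definition _ := isPointed.Build (padic p) 0.

(* The p-adic topology: the balls {y | y = x mod p^(k+1)} form a basis. *)
Definition padic_open (A : set (padic p)) : Prop :=
  forall x, A x -> exists k, forall y, y k = x k -> A y.

Lemma padic_eq_le x y j k : (j <= k)%N -> y k = x k -> y j = x j.
Proof.
elim: k => [|k IH]; first by rewrite leqn0 => /eqP ->.
rewrite leq_eqVlt => /orP[/eqP -> //|jk] yx; apply: IH => //.
by rewrite -(residue_compat y k) -(residue_compat x k) yx.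
Qed.

Lemma padic_openT : padic_open setT.
Proof. by move=> x _; exists 0%N. Qed.

Lemma padic_openI A B : padic_open A -> padic_open B -> padic_open (A `&` B).
Proof.
move=> oA oB x [/oA[j hj] /oB[k hk]]; exists (maxn j k) => y yx; split.
  by apply/hj/(padic_eq_le _ yx)/leq_maxl.
by apply/hk/(padic_eq_le _ yx)/leq_maxr.
Qed.

Lemma padic_open_bigcup (I : Type) (F : I -> set (padic p)) :
  (forall i, padic_open (F i)) -> padic_open (\bigcup_i F i).
Proof.
move=> oF x [i _ /oF[k hk]]; exists k => y yx; exists i => //; exact: hk.
Qed.

HB.instance Definition _ := isOpenTopological.Build (padic p)
  padic_openT padic_openI padic_open_bigcup.

HB.instance Definition _ := @isMeasurable.Build
  (sigma_display (@open (padic p))) (padic p) <<s @open (padic p) >>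
  (@sigma_algebra0 _ setT _) (@sigma_algebraC _ _)
  (@sigma_algebra_bigcup _ setT _).

End PadicRing.

Section Cokernel.
Variables (A : comNzRingType) (n : nat) (M : 'M[A]_n).

Definition col_image : {pred 'cV[A]_n} :=
  [pred v | `[< exists u : 'cV[A]_n, v = M *m u >]].

Lemma col_image_zmod_closed : zmod_closed col_image.
Proof.
split=> [|_ _ /asboolP[u ->] /asboolP[v ->]]; apply/asboolP.
  by exists 0; rewrite mulmx0.
by exists (u - v); rewrite mulmxBr.
Qed.

HB.instance Definition _ :=
  GRing.isZmodClosed.Build 'cV[A]_n col_image col_image_zmod_closed.

Definition cok : zmodType := Quotient.quot col_image.

End Cokernel.

Definition zmod_isog (U V : zmodType) : Prop :=
  exists f : {additive U -> V}, bijective f.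

Section RandomMatrices.
Context (R : realType) (p : nat) (d : measure_display) (T : measurableType d)
  (P : probability T R).

Definition independent (I : finType) (J : {set I}) (X : I -> T -> padic p) :=
  forall (K : {set I}) (B : I -> set (padic p)), K \subset J ->
    (forall i, measurable (B i)) ->
    P (\bigcap_(i in [set` K]) (X i @^-1` B i)) =
      (\prod_(i in K) P (X i @^-1` B i))%E.

(* Regularity is not required: finite Borel measures on the compact metrizable
   group Z_p are automatically regular. *)
Definition is_haar (mu : set (padic p) -> \bar R) : Prop :=
  mu setT = 1%E /\
  forall (a : padic p) (B : set (padic p)), measurable B ->
    mu [set a + x | x in B] = mu B.

Definition haar_distributed (X : T -> padic p) : Prop :=
  is_haar (pushforward P X).

(* The two masses add up to 1, so they determine the law. *)
Definition bernoulli_distributed (eps : R) (X : T -> padic p) : Prop :=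
  P (X @^-1` [set 0]) = (1 - eps)%:E /\ P (X @^-1` [set 1]) = eps%:E.

Variables (n : nat) (Sigma : n.-tuple {set 'I_n}).

Definition support_set : {set 'I_n * 'I_n} :=
  [set ij | ij.1 \in tnth Sigma ij.2]%SET.

(* Q is a condition on the law of a single entry. *)
Definition random_matrix_on (Q : (T -> padic p) -> Prop)
    (X : T -> 'M[padic p]_n) : Prop :=
  [/\ forall i j, measurable_fun setT (fun w => X w i j),
      forall i j, i \notin tnth Sigma j -> forall w, X w i j = 0,
      forall i j, i \in tnth Sigma j -> Q (fun w => X w i j) &
      independent support_set (fun ij w => X w ij.1 ij.2)].

Definition haar_matrix_on := random_matrix_on haar_distributed.

Definition bernoulli_matrix_on (eps : R) :=
  random_matrix_on (bernoulli_distributed eps).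

End RandomMatrices.

(* A finZmodType is also a finGroupType, with its addition as group law. *)
Definition CL_prob (R : realType) (p : nat) (H : finZmodType) : R :=
  (#|Aut [set: H]%SET|%:R)^-1 *
  limn (fun N => \prod_(1 <= i < N.+1) (1 - p%:R ^- i) : R).

Definition cok_converges_to_CL (R : realType) (p : nat)
    (d : nat -> measure_display) (T : forall n, measurableType (d n))
    (P : forall n, probability (T n) R)
    (Z : forall n, T n -> 'M[padic p]_n) : Prop :=
  forall H : finZmodType, (p.-group [set: H]%SET)%g ->
    P n [set w | zmod_isog (cok (Z n w)) H] @[n --> \oo]
      --> (CL_prob R p H)%:E.

(* Main.v *)
Require Import Defs.
From HB Require Import structures.
From mathcomp Require Import all_boot all_order all_fingroup all_algebra all_solvable.

(* Let a = 1 - eps > 1/p and choose b with 1/p < b < a. The first m columns of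
   Sigma_n have pairwise disjoint supports of size k, and all other columns are
   full, where m is about b^-k and k tends slowly to infinity with n.

   A sparse column of Y_n vanishes with probability a^k and m * a^k tends to
   infinity, so Y_n has a zero column with probability tending to 1 and cok(Y_n) is
   trivial with probability tending to 0, whereas the Cohen-Lenstra probability
   of the trivial group is positive.

   For X_n write N = n - m. A sparse column is zero mod p with probability p^-k
   and m * p^-k tends to 0; if no sparse column is zero mod p, disjointness of
   the supports gives the sparse part A a left inverse. For a p-group H of order
   p^e everything can be read off modulo q = p^(e+1). Count pairs (h, B), where
   h : (Z/q)^n -> H is surjective with kernel L equal to the column span of
   (A | B): given B there are |Aut H| or 0 such h. Conversely, the surjections h
   killing A number |H|^N (1 - o(1)), because only a fraction O(2^-N) of the
   N-tuples lies in a proper subgroup of H, and for each of them the columns of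
   B extend A to a generating family of L in |L|^N prod_{i <= N} (1 - p^-i)
   ways, because L / pL has dimension n and A spans an m-dimensional subspace. *)

Set Implicit Arguments.
Unset Strict Implicit.
Unset Printing Implicit Defensive.
Import Order.TTheory GRing.Theory Num.Theory.
Local Open Scope ring_scope.

(** * Counting matrices over Z/p^(e+1) with prescribed cokernel *)

Section FiniteZmod.
Implicit Types U W : finZmodType.

Lemma group0r U (G : {group U}) : 0 \in G.
Proof. exact: group1. Qed.

Lemma groupDr U (G : {group U}) x y : x \in G -> y \in G -> x + y \in G.
Proof. exact: groupM. Qed.

Lemma groupMnr U (G : {group U}) x k : x \in G -> x *+ k \in G.
Proof.
by move=> Gx; elim: k => [|k IH]; rewrite ?group0r // mulrS groupDr.
Qed.

Lemma mulrn_card U (x : U) : x *+ #|U| = 0.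
Proof. by rewrite -cardsT -FinRing.zmodXgE; apply: expg_cardG; rewrite inE. Qed.

Lemma group_sumr U (G : {group U}) (I : Type) (r : seq I) (P : pred I) F :
  (forall i, P i -> F i \in G) -> \sum_(i <- r | P i) F i \in G.
Proof.
by move=> FG; apply: (big_ind (fun x => x \in G));
  [exact: group0r | exact: groupDr | ].
Qed.

Lemma group_setr U (S : {set U}) :
  0 \in S -> (forall x y, x \in S -> y \in S -> x + y \in S) -> group_set S.
Proof. by move=> S0 SD; apply/group_setP; split. Qed.

Lemma card_additive_image U W (f : U -> W) (G : {group U}) :
  {morph f : x y / x + y} ->
  #|G| = (#|f @: G| * #|[set x in G | f x == 0%R]|)%N.
Proof.
move=> fD.
have fM : {in [set: U] &, {morph f : x y / (x * y)%g}} by move=> x y _ _; exact: fD.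
pose F := Morphism fM.
have := card_morphim F G; rewrite morphimE setTI => ->.
rewrite -(LagrangeI G ('ker F)) mulnC; congr (_ * _)%N.
by apply: eq_card => x; rewrite !inE.
Qed.

Lemma card_row_in (U : finZmodType) n (G : {set U}) :
  #|[set h : 'rV[U]_n | [forall i, h 0 i \in G]]| = (#|G| ^ n)%N.
Proof.
rewrite -[X in (_ ^ X)%N]card_ord -(card_ffun_on 'I_n (mem G)).
pose f (g : {ffun 'I_n -> U}) : 'rV[U]_n := \row_i g i.
have f_inj : injective f.
  by move=> g g' /rowP e; apply/ffunP => i; move: (e i); rewrite !mxE.
rewrite -(card_imset _ f_inj); apply: eq_card => h; rewrite !inE.
apply/forallP/imsetP => [hG|[g /ffun_onP gG -> i]]; last by rewrite mxE.
exists [ffun i => h 0 i]; last by apply/rowP => i; rewrite mxE ffunE.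
by apply/ffun_onP => i; rewrite ffunE.
Qed.

Lemma card_bigcup_le (I U : finType) (P : pred I) (F : I -> {set U}) :
  (#|\bigcup_(i | P i) F i| <= \sum_(i | P i) #|F i|)%N.
Proof.
elim/big_rec2: _ => [|i k S _ le]; first by rewrite cards0.
by apply: leq_trans (leq_card_setU _ _) _; rewrite leq_add2l.
Qed.

(** A proper subgroup has index at least 2; this is the source of the error term 2^-N. *)
Lemma double_card_proper U (G : {group U}) :
  G != [set: U] :> {set U} -> (2 * #|G| <= #|U|)%N.
Proof.
move=> GT; rewrite -(cardsT U) -(Lagrange (subsetT G)) mulnC leq_pmul2l ?cardG_gt0 //.
by rewrite indexg_gt1 subTset.
Qed.

End FiniteZmod.

Lemma sum_row_mx (F : finType) n m N (f : 'M[F]_(n, m + N) -> nat) :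
  (\sum_M f M = \sum_(A : 'M_(n, m)) \sum_(B : 'M_(n, N)) f (row_mx A B))%N.
Proof.
rewrite pair_big /=.
rewrite (reindex (fun AB : 'M[F]_(n, m) * 'M_(n, N) => row_mx AB.1 AB.2)) //=.
exists (fun M => (lsubmx M, rsubmx M)) => [[A B] _|M _] /=.
  by rewrite row_mxKl row_mxKr.
by rewrite hsubmxK.
Qed.

(** * Residues modulo p and p-torsion in (Z/q)^n *)

Section ModPrimePower.
Variables (p e : nat).
Hypothesis p_pr : prime p.
Local Notation q := (p ^ e.+1)%N.
Local Notation Zq := 'Z_(p ^ e.+1).

Let p_gt1 : (1 < p)%N := prime_gt1 p_pr.
Let p_gt0 : (0 < p)%N := prime_gt0 p_pr.

Lemma modulus_gt1 : (1 < q)%N.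
Proof. by rewrite -(exp1n e.+1) ltn_exp2r. Qed.

Lemma Zq_char : q%:R = 0 :> Zq.
Proof. exact: (pchar_Zp modulus_gt1). Qed.

Lemma Zq_nat_eq0 k : (k%:R == 0 :> Zq) = (q %| k)%N.
Proof.
have /= -> := Zp_nat (Zp_trunc q) k.
by rewrite -val_eqE /= (Zp_cast modulus_gt1) /dvdn.
Qed.

Lemma card_Zq : #|{: Zq}| = q.
Proof. by rewrite card_ord (Zp_cast modulus_gt1). Qed.

Lemma Zq_divp (a : Zq) : a = (a %% p)%N%:R + (a %/ p)%N%:R *+ p.
Proof. by rewrite -{1}(natr_Zp a) {1}(divn_eq a p) natrD natrM mulr_natr addrC. Qed.

(** Standard representatives of (Z/q)^n modulo p; they let cosets be counted without forming a
    quotient module. *)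
Definition of_digits n (u : 'cV['I_p]_n) : 'cV[Zq]_n :=
  map_mx (fun i : 'I_p => (i : nat)%:R) u.

Lemma cV_divp n (v : 'cV[Zq]_n) :
  exists (u : 'cV['I_p]_n) (w : 'cV[Zq]_n), v = of_digits u + w *+ p.
Proof.
exists (map_mx (fun a : Zq => Ordinal (ltn_pmod a p_gt0)) v).
exists (map_mx (fun a : Zq => (a %/ p)%N%:R) v).
by apply/matrixP => i j; rewrite mxE mulmxnE !mxE -Zq_divp.
Qed.

(** The two sides differ by p^e (a - b), which q divides only if p divides a - b. *)
Lemma digit_inj (a b : 'I_p) :
  (p ^ e * a)%N%:R = (p ^ e * b)%N%:R :> Zq -> a = b.
Proof.
move=> ab; apply: val_inj => /=; move: ab.
wlog le_ba : a b / (b <= a)%N.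
  by move=> W; case/orP: (leq_total b a) => h; [|move/esym => E; symmetry]; auto.
move=> /eqP; rewrite -subr_eq0 -natrB ?leq_mul2l ?le_ba ?orbT //.
rewrite Zq_nat_eq0 -mulnBr expnSr dvdn_pmul2l ?expn_gt0 ?p_gt0 // => dv.
apply/eqP; rewrite eqn_leq le_ba andbT -subn_eq0.
have : (a - b < p)%N by apply: leq_ltn_trans (leq_subr _ _) (ltn_ord a).
by apply: contraTT; rewrite -leqNgt => ab; apply: dvdn_leq; rewrite ?lt0n.
Qed.

(** Multiplication by p^e kills w p and is injective on digits. *)
Lemma of_digits_inj n (u u' : 'cV['I_p]_n) w :
  of_digits u - of_digits u' = w *+ p -> u = u'.
Proof.
move=> /matrixP uw; apply/matrixP => i j; apply: digit_inj.
have := uw i j; rewrite !mxE mulmxnE => ab.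
apply/eqP; rewrite -subr_eq0 !natrM -mulrBr ab -(mulr_natr (w i j)) mulrCA -natrM.
by rewrite -expnSr Zq_char mulr0.
Qed.

Lemma card_digits n : #|{: 'cV['I_p]_n}| = (p ^ n)%N.
Proof. by rewrite card_mx card_ord muln1. Qed.

Lemma cVq_torsion n (v : 'cV[Zq]_n) : v *+ q = 0.
Proof. by apply/matrixP => i j; rewrite mulmxnE mxE -mulr_natr Zq_char mulr0. Qed.

(** As an integer, an entry killed by p is a multiple of p^e below p^(e+1), so the quotient is a
    digit. *)
Lemma p_torsion_digits n (v : 'cV[Zq]_n) :
  v *+ p = 0 -> exists u : 'cV['I_p]_n, v = of_digits u *+ (p ^ e).
Proof.
move=> vp; have vd i : (p ^ e %| v i 0%R)%N.
  have /matrixP/(_ i 0) := vp; rewrite mulmxnE mxE => /eqP.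
  rewrite -{1}(natr_Zp (v i 0)) -mulrnA Zq_nat_eq0 [X in (X %| _)%N -> _]expnSr.
  by rewrite dvdn_pmul2r.
have lt i : (v i 0%R %/ p ^ e < p)%N.
  rewrite ltn_divLR ?expn_gt0 ?p_gt0 // -expnS.
  by have := ltn_ord (v i 0); rewrite [X in (_ < X)%N -> _](Zp_cast modulus_gt1).
exists (\col_i Ordinal (lt i)).
apply/matrixP => i j; rewrite ord1 mulmxnE !mxE /=.
by rewrite -mulrnA divnK ?vd // natr_Zp.
Qed.

Lemma card_p_torsion n :
  #|[set v : 'cV[Zq]_n | v *+ p == 0]| = (p ^ n)%N.
Proof.
pose f (u : 'cV['I_p]_n) : 'cV[Zq]_n := of_digits u *+ (p ^ e).
have f_inj : injective f.
  move=> u u' /matrixP uu; apply/matrixP => i j; apply: digit_inj.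
  by have := uu i j; rewrite !mulmxnE !mxE -!mulrnA ![(p ^ e * _)%N]mulnC.
rewrite -[RHS]card_digits -[RHS]cardsT -[RHS](card_imset _ f_inj).
apply: eq_card => v.
rewrite inE; apply/eqP/imsetP => [vp|[u _ ->]]; last first.
  by rewrite /f -mulrnA -expnSr cVq_torsion.
have [u ->] := p_torsion_digits vp; by exists u.
Qed.

(** * Counting generating families of a submodule of (Z/q)^n *)

Section Span.
Variable n : nat.
Local Notation V := 'cV[Zq]_n.

(** The submodule D + im B. The base D will be pL enlarged by some columns, so that generation of L
    can be counted one column at a time. *)
Definition join_span N (D : {set V}) (B : 'M[Zq]_(n, N)) : {set V} :=
  [set x.1 + B *m x.2 | x in setX D [set: 'cV[Zq]_N]].

Lemma join_spanP N (D : {set V}) (B : 'M[Zq]_(n, N)) v :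
  reflect (exists2 d, d \in D & exists u, v = d + B *m u) (v \in join_span D B).
Proof.
apply: (iffP imsetP) => [[[d u]]|[d Dd [u ->]]].
  by rewrite !inE andbT => Dd ->; exists d => //; exists u.
by exists (d, u); rewrite // !inE Dd.
Qed.

Lemma join_span_group_set N (D : {group V}) (B : 'M[Zq]_(n, N)) :
  group_set (join_span D B).
Proof.
apply: group_setr => [|_ _ /join_spanP[d Dd [u ->]] /join_spanP[d' Dd' [u' ->]]].
  by apply/join_spanP; exists 0; [exact: group0r | exists 0; rewrite mulmx0 addr0].
apply/join_spanP; exists (d + d'); first exact: groupDr.
by exists (u + u'); rewrite mulmxDr addrACA.
Qed.

Canonical join_span_group N (D : {group V}) (B : 'M[Zq]_(n, N)) :=
  Group (join_span_group_set D B).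

Lemma sub_join_span N (D : {set V}) (B : 'M[Zq]_(n, N)) : D \subset join_span D B.
Proof.
by apply/subsetP => d Dd; apply/join_spanP; exists d => //; exists 0; rewrite mulmx0 addr0.
Qed.

Lemma join_span_row_mx N N' (D : {set V}) (B : 'M[Zq]_(n, N)) (C : 'M_(n, N')) :
  join_span D (row_mx B C) = join_span (join_span D B) C.
Proof.
apply/setP => v; apply/join_spanP/join_spanP => [[d Dd [u ->]]|].
  exists (d + B *m usubmx u); first by apply/join_spanP; exists d => //; exists (usubmx u).
  by exists (dsubmx u); rewrite -addrA -mul_row_col vsubmxK.
move=> [_ /join_spanP[d Dd [u ->]] [w ->]]; exists d => //.
by exists (col_mx u w); rewrite mul_row_col addrA.
Qed.

Lemma groupZ (G : {group V}) a v : v \in G -> a *: v \in G.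
Proof. by move=> Gv; rewrite -(natr_Zp a) scaler_nat groupMnr. Qed.

Lemma mulmx_cV1 (x : V) (u : 'cV[Zq]_1) : x *m u = u 0 0 *: x.
Proof. by apply/colP => i; rewrite !mxE big_ord1 mulrC. Qed.

(** Modulo D the vector B u depends only on u modulo p, and there are p^N digit vectors. *)
Lemma card_join_span_le N (D : {group V}) (B : 'M[Zq]_(n, N)) :
  (forall u, (B *m u) *+ p \in D) -> (#|join_span D B| <= p ^ N * #|D|)%N.
Proof.
move=> BD; rewrite -(card_digits N) mulnC -[#|{: _}|]cardsT -cardsX.
apply: leq_trans (leq_imset_card (fun x => x.1 + B *m of_digits x.2) _).
apply/subset_leq_card/subsetP => _ /join_spanP[d Dd [u ->]].
have [u0 [w ->]] := cV_divp u; apply/imsetP.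
exists (d + (B *m w) *+ p, u0); first by rewrite !inE /= groupDr.
by rewrite /= mulmxDr (raddfMn (mulmx B)) /= -addrA [_ *+ p + _]addrC.
Qed.

(** The index of D is at most p by the previous bound, greater than 1, and a power of p because the
    ambient group is a p-group. *)
Lemma card_join_span1 (D : {group V}) (x : V) :
  x *+ p \in D -> x \notin D -> #|join_span D x| = (p * #|D|)%N.
Proof.
move=> xpD xD; apply/eqP; rewrite eqn_leq; apply/andP; split.
  rewrite -{2}(expn1 p); apply: card_join_span_le => u.
  by rewrite mulmx_cV1 scalerMnr groupZ.
have sD := sub_join_span D x.
have pidx : p.-nat #|join_span_group D x : D|%g.
  apply: (@pnat_dvd _ #|[set: V]|).
    by apply: dvdn_trans (dvdn_indexg _ _) (cardSg (subsetT _)).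
  by rewrite cardsT card_mx card_Zq -expnM pnatX pnat_id.
have idx1 : (1 < #|join_span_group D x : D|%g)%N.
  rewrite indexg_gt1; apply: contra xD => /subsetP; apply.
  apply/join_spanP; exists 0; rewrite ?group0r //.
  by exists 1; rewrite mulmx1 add0r.
have /p_natP[k kE] := pidx.
rewrite -(Lagrange sD) mulnC leq_pmul2l ?cardG_gt0 //= kE.
by move: idx1; rewrite kE; case: k {kE} => // k _; rewrite expnS leq_pmulr ?expn_gt0 ?p_gt0.
Qed.

(** L / D is an F_p-vector space of dimension N, and its bases are counted: the first column is any
    element of L outside D, and the induction continues with D enlarged by it. *)
Lemma card_join_span_eq N (L D : {group V}) :
  D \subset L -> (forall v, v \in L -> v *+ p \in D) ->
  #|L| = (p ^ N * #|D|)%N ->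
  #|[set B : 'M[Zq]_(n, N) | join_span D B == L]| =
    (\prod_(i < N) (#|L| - p ^ i * #|D|))%N.
Proof.
elim: N D => [|N IH] D sDL pLD cLD.
  rewrite big_ord0; have DL : D :=: L.
    by apply/eqP; rewrite eqEcard sDL cLD mul1n leqnn.
  rewrite (_ : [set _ | _] = [set 0]) ?cards1 //; apply/setP => B.
  rewrite !inE [B]thinmx0 eqxx -DL; apply/eqP/setP => v.
  apply/join_spanP/idP => [[d Dd [u ->]]|Dv]; first by rewrite mul0mx addr0.
  by exists v => //; exists 0; rewrite mulmx0 addr0.
rewrite -sum1_card big_mkcond /=.
rewrite (sum_row_mx (fun B : 'M_(n, 1 + N) =>
  if B \in [set B | join_span D B == L] then 1%N else 0%N)) /=.
have cnt (x : V) : (\sum_(B : 'M[Zq]_(n, N))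
     (if row_mx x B \in [set B | join_span D B == L] then 1 else 0))%N =
   #|[set B : 'M[Zq]_(n, N) | join_span (join_span D x) B == L]|.
  rewrite -sum1_card [RHS]big_mkcond; apply: eq_bigr => B _.
  by rewrite !inE join_span_row_mx.
rewrite (eq_bigr _ (fun x _ => cnt x)) {cnt}.
(* A first column outside L never occurs. One inside D adds nothing, and the other N columns reach
   at most p^N |D| elements, fewer than |L|. *)
rewrite (bigID (mem (L :\: D))) /= [X in (_ + X)%N]big1 ?addn0; last first.
  move=> x; rewrite inE negb_and negbK => xDL; apply/eqP; rewrite cards_eq0.
  apply/eqP/setP => B; rewrite !inE; apply/negP => /eqP E.
  have xL : x \in L.
    rewrite -E; apply: (subsetP (sub_join_span _ _)); apply/join_spanP.
    by exists 0; rewrite ?group0r //; exists 1; rewrite mulmx1 add0r.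
  move: xDL; rewrite xL orbF => xD.
  have EDx : join_span D x = D.
    apply/setP => v; apply/join_spanP/idP => [[d Dd [u ->]]|Dv].
      by rewrite mulmx_cV1 groupDr ?groupZ.
    by exists v => //; exists 0; rewrite mulmx0 addr0.
  rewrite EDx in E.
  have : (#|join_span D B| <= p ^ N * #|D|)%N.
    apply: card_join_span_le => u; apply: pLD; rewrite -E.
    by apply/join_spanP; exists 0; rewrite ?group0r //; exists u; rewrite add0r.
  by rewrite E cLD leq_pmul2r ?cardG_gt0 // leq_exp2l // ltnn.
rewrite (eq_bigr (fun=> \prod_(i < N) (#|L| - p ^ i.+1 * #|D|))%N); last first.
  move=> x; rewrite inE => /andP[xD xL].
  have cD' := card_join_span1 (pLD x xL) xD.
  rewrite (IH (join_span_group D x)) /= ?cD'.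
  - by apply: eq_bigr => i _; rewrite mulnA -expnSr.
  - apply/subsetP => _ /join_spanP[d Dd [u ->]].
    by rewrite mulmx_cV1 groupDr ?groupZ // (subsetP sDL).
  - by move=> v vL; apply: (subsetP (sub_join_span D x)); exact: pLD.
  - by rewrite cLD mulnA -expnSr.
rewrite sum_nat_const cardsD (setIidPr sDL) big_ord_recl expn0 mul1n.
by congr (_ * _)%N.
Qed.

End Span.

(** * Homomorphisms from (Z/q)^n to H and presentations of H *)

Section Action.
Variable H : finZmodType.
Hypothesis H_torsion : forall x : H, x *+ (p ^ e) = 0.

Lemma mulrn_modq (x : H) k : x *+ (k %% q) = x *+ k.
Proof.
by rewrite [in RHS](divn_eq k q) mulrnDr
  mulnC !mulrnA expnSr mulnC mulrnA H_torsion mul0rn add0r.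
Qed.

(** Z/q acts on H through representatives; as q kills H, their choice does not matter. *)
Lemma mulrn_Zq_nat (x : H) k : x *+ (k%:R : Zq) = x *+ k.
Proof.
have /= -> := Zp_nat (Zp_trunc q) k.
by rewrite /= (Zp_cast modulus_gt1) mulrn_modq.
Qed.

Lemma mulrn_ZqD (x : H) (a b : Zq) : x *+ (a + b : Zq)%R = x *+ a + x *+ b.
Proof. by rewrite -{1}(natr_Zp a) -{1}(natr_Zp b) -natrD mulrn_Zq_nat mulrnDr. Qed.

Lemma mulrn_ZqM (x : H) (a b : Zq) : x *+ (a * b : Zq)%R = x *+ a *+ b.
Proof. by rewrite -{1}(natr_Zp a) -{1}(natr_Zp b) -natrM mulrn_Zq_nat mulrnA. Qed.

(* A row h encodes the homomorphism (Z/q)^n -> H sending the i-th basis vector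
   to h 0 i; then hmul h A is its composition with A. *)
Definition hmul n m (h : 'rV[H]_n) (A : 'M[Zq]_(n, m)) : 'rV[H]_m :=
  \row_j \sum_i h 0 i *+ (A i j).

Lemma hmulDl n m (A : 'M[Zq]_(n, m)) : {morph (fun h => hmul h A) : h h' / h + h'}.
Proof.
move=> h h'; apply/rowP => j; rewrite !mxE -big_split /=; apply: eq_bigr => i _.
by rewrite mxE mulrnDl.
Qed.

Lemma hmulDr n m (h : 'rV[H]_n) : {morph @hmul n m h : A B / A + B}.
Proof.
move=> A B; apply/rowP => j; rewrite !mxE -big_split /=; apply: eq_bigr => i _.
by rewrite mxE mulrn_ZqD.
Qed.

Lemma hmul0r n m (h : 'rV[H]_n) : hmul h (0 : 'M[Zq]_(n, m)) = 0.
Proof. by apply: (addrI (hmul h 0)); rewrite -hmulDr !addr0. Qed.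

Lemma hmulMn n m (h : 'rV[H]_n) (A : 'M[Zq]_(n, m)) k :
  hmul h (A *+ k) = hmul h A *+ k.
Proof. by elim: k => [|k IH]; rewrite ?mulr0n ?hmul0r // !mulrS hmulDr IH. Qed.

Lemma hmul0l n m (A : 'M[Zq]_(n, m)) : hmul 0 A = 0.
Proof. by apply: (addrI (hmul 0 A)); rewrite -hmulDl !addr0. Qed.

Lemma mulrn_Zq_sum (x : H) I (r : seq I) (F : I -> Zq) :
  x *+ (\sum_(i <- r) F i : Zq)%R = \sum_(i <- r) x *+ F i.
Proof.
elim: r => [|i r IH]; first by rewrite !big_nil.
by rewrite !big_cons mulrn_ZqD IH.
Qed.

Lemma hmulA n m l (h : 'rV[H]_n) (A : 'M[Zq]_(n, m)) (B : 'M_(m, l)) :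
  hmul (hmul h A) B = hmul h (A *m B).
Proof.
apply/rowP => j; rewrite !mxE.
under eq_bigr do rewrite mxE -sumrMnl.
rewrite exchange_big; apply: eq_bigr => i _ /=.
by rewrite mxE mulrn_Zq_sum; apply: eq_bigr => k _; rewrite mulrn_ZqM.
Qed.

Lemma hmul1 n (h : 'rV[H]_n) : hmul h 1%:M = h.
Proof.
apply/rowP => j; rewrite !mxE (bigD1 j) //= big1 => [|i ij].
  by rewrite mxE eqxx addr0 mulr1n.
by rewrite mxE (negPf ij).
Qed.

Lemma hmul_row_mx n m l (h : 'rV[H]_n) (A : 'M[Zq]_(n, m)) (B : 'M_(n, l)) :
  hmul h (row_mx A B) = row_mx (hmul h A) (hmul h B).
Proof.
apply/rowP => j; rewrite !mxE; case: (split_ordP j) => k ->;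
by rewrite ?(row_mxEl, row_mxEr) mxE; apply: eq_bigr => i _; rewrite ?(row_mxEl, row_mxEr).
Qed.

Definition eval_hom n (h : 'rV[H]_n) (v : 'cV[Zq]_n) : H := hmul h v 0 0.

Lemma eval_homD n (h : 'rV[H]_n) : {morph eval_hom h : v w / v + w}.
Proof. by move=> v w; rewrite /eval_hom hmulDr mxE. Qed.

Lemma eval_homMn n (h : 'rV[H]_n) v k : eval_hom h (v *+ k) = eval_hom h v *+ k.
Proof. by rewrite /eval_hom hmulMn mulmxnE. Qed.

Lemma eval_hom_delta n (h : 'rV[H]_n) i : eval_hom h (delta_mx i 0) = h 0 i.
Proof.
rewrite /eval_hom mxE (bigD1 i) //= big1 => [|k ki].
  by rewrite mxE !eqxx addr0 mulr1n.
by rewrite mxE (negPf ki).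
Qed.

Lemma eval_hom_eq0 n (h : 'rV[H]_n) v : (eval_hom h v == 0) = (hmul h v == 0).
Proof.
rewrite /eval_hom; apply/eqP/eqP => [h0|->]; last by rewrite mxE.
by apply/rowP => j; rewrite ord1 h0 mxE.
Qed.

Definition ker_hom n (h : 'rV[H]_n) : {set 'cV[Zq]_n} := [set v | eval_hom h v == 0].

Lemma ker_hom_group_set n (h : 'rV[H]_n) : group_set (ker_hom h).
Proof.
apply: group_setr => [|x y]; rewrite !inE; first by rewrite eval_hom_eq0 hmul0r.
by rewrite eval_homD => /eqP -> /eqP ->; rewrite addr0.
Qed.

Canonical ker_hom_group n (h : 'rV[H]_n) := Group (ker_hom_group_set h).

Definition onto_hom n (h : 'rV[H]_n) := [forall x, [exists v, eval_hom h v == x]].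

Lemma onto_homP n (h : 'rV[H]_n) :
  reflect (forall x, exists v, eval_hom h v = x) (onto_hom h).
Proof.
apply: (iffP forallP) => hE x; first by have /existsP[v /eqP] := hE x; exists v.
by have [v vx] := hE x; apply/existsP; exists v; rewrite vx.
Qed.

Lemma card_ker_hom n (h : 'rV[H]_n) :
  onto_hom h -> (#|H| * #|ker_hom h| = q ^ n)%N.
Proof.
move=> /onto_homP hS.
have := card_additive_image [set: 'cV[Zq]_n]%G (@eval_homD n h).
rewrite cardsT card_mx muln1 card_Zq => ->; congr (_ * _)%N; last first.
  by apply: eq_card => v; rewrite !inE.
rewrite -cardsT; apply: eq_card => x; rewrite inE; symmetry; apply/imsetP.
by have [v <-] := hS x; exists v.
Qed.

Definition mulp_set n (L : {set 'cV[Zq]_n}) : {set 'cV[Zq]_n} := [set v *+ p | v in L].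

Lemma mulp_group_set n (L : {group 'cV[Zq]_n}) : group_set (mulp_set L).
Proof.
apply: group_setr => [|_ _ /imsetP[x Lx ->] /imsetP[y Ly ->]].
  by apply/imsetP; exists 0; rewrite ?group0r ?mul0rn.
by apply/imsetP; exists (x + y); rewrite ?groupDr ?mulrnDl.
Qed.

Canonical mulp_group n (L : {group 'cV[Zq]_n}) := Group (mulp_group_set L).

(* L / pL is as large as the p-torsion of L, and all p-torsion of (Z/q)^n lies
   in L because it is divisible by p^e, which kills H. *)
Lemma card_mulp_ker n (h : 'rV[H]_n) :
  #|ker_hom h| = (p ^ n * #|mulp_set (ker_hom h)|)%N.
Proof.
have := @card_additive_image _ _ (fun v : 'cV[Zq]_n => v *+ p) (ker_hom_group h) (mulrnDl p).
rewrite [LHS]/= => ->; rewrite mulnC; congr (_ * _)%N.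
rewrite -[RHS]card_p_torsion; apply: eq_card => v; rewrite !inE.
rewrite andbC; case: eqP => //= vp.
have [u ->] := p_torsion_digits vp.
by rewrite eval_homMn H_torsion eqxx.
Qed.

Definition col_span n m (M : 'M[Zq]_(n, m)) : {set 'cV[Zq]_n} :=
  [set M *m u | u in [set: 'cV[Zq]_m]].

Lemma col_spanP n m (M : 'M[Zq]_(n, m)) v :
  reflect (exists u, v = M *m u) (v \in col_span M).
Proof.
by apply: (iffP imsetP) => [[u _ ->]|[u ->]]; exists u.
Qed.

(* Nakayama's lemma for the Zq-module L. *)
Lemma join_span_mulp n m (L : {group 'cV[Zq]_n}) (M : 'M[Zq]_(n, m)) :
  (join_span (mulp_set L) M == L) = (col_span M == L).
Proof.
apply/eqP/eqP => [ML|ML]; apply/eqP; rewrite eqEsubset; apply/andP; split.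
- apply/subsetP => _ /col_spanP[u ->]; rewrite -ML; apply/join_spanP.
  by exists 0; [exact: (group0r (mulp_group L)) | exists u; rewrite add0r].
- apply/subsetP => v Lv.
  have step k : exists u, exists2 l, l \in L & v = M *m u + l *+ (p ^ k).
    elim: k => [|k [u [l Ll vE]]].
      by exists 0, v; rewrite // mulmx0 add0r.
    move: Ll; rewrite -{1}ML => /join_spanP[_ /imsetP[l' Ll' ->] [u' lE]].
    exists (u + u' *+ (p ^ k)), l' => //.
    rewrite vE lE mulmxDr (raddfMn (mulmx M)) /= mulrnDl -mulrnA -expnS.
    by rewrite -addrA [_ *+ (p ^ k) + _]addrC.
  have [u [l _ ->]] := step e.+1.
  by rewrite cVq_torsion addr0; apply/col_spanP; exists u.
- apply/subsetP => _ /join_spanP[_ /imsetP[l Ll ->] [u ->]].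
  by rewrite groupDr ?groupMnr // -ML; apply/col_spanP; exists u.
- apply/subsetP => v; rewrite -ML => /col_spanP[u ->]; apply/join_spanP.
  by exists 0; [rewrite ML; exact: (group0r (mulp_group L)) | exists u; rewrite add0r].
Qed.

(* Nonempty exactly when the cokernel of M is isomorphic to H. *)
Definition presentations n m (M : 'M[Zq]_(n, m)) : {set 'rV[H]_n} :=
  [set h | onto_hom h & col_span M == ker_hom h].

(** Two surjections onto H with the same kernel differ by a unique automorphism of H, so Aut H acts
    simply transitively. *)
Lemma card_presentations n m (M : 'M[Zq]_(n, m)) h0 :
  h0 \in presentations M -> #|presentations M| = #|Aut [set: H]|.
Proof.
rewrite inE => /andP[/onto_homP onto0 /eqP ker0].
have homE (h : 'rV[H]_n) (f : H -> H) : {morph f : x y / x + y} ->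
    forall v, eval_hom (map_mx f h) v = f (eval_hom h v).
  move=> fD v; have f0 : f 0 = 0 by apply: (addrI (f 0)); rewrite -fD !addr0.
  have fMn x k : f (x *+ k) = f x *+ k.
    by elim: k => [|k IH]; rewrite ?mulr0n // !mulrS fD IH.
  rewrite /eval_hom !mxE (big_morph f fD f0); apply: eq_bigr => i _.
  by rewrite fMn mxE.
pose F (a : {perm H}) := map_mx a h0.
have AutD a : a \in Aut [set: H] -> {morph a : x y / x + y}.
  by move=> /Aut_morphic/morphicP aM x y; apply: aM; rewrite inE.
have F_inj : {in Aut [set: H] &, injective F}.
  move=> a b /AutD aD /AutD bD ab; apply/permP => x; have [v <-] := onto0 x.
  by rewrite -!homE // -/(F a) ab.
rewrite -(card_in_imset F_inj); apply: eq_card => h; rewrite inE.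
apply/andP/imsetP => [[/onto_homP onto_h /eqP ker_h]|[a aA ->]].
  have sub v w : eval_hom h0 v = eval_hom h0 w <-> eval_hom h v = eval_hom h w.
    have dE (g : 'rV[H]_n) x y : (eval_hom g x == eval_hom g y) = (x - y \in ker_hom g).
      by rewrite inE -{1}(subrK y x) (eval_homD _ (x - y)) -subr_eq0 addrK.
    by split=> /eqP E; apply/eqP; move: E; rewrite !dE -ker0 -ker_h.
  have ex x : exists v, eval_hom h0 v == x by have [v <-] := onto0 x; exists v.
  (* The automorphism is h after an arbitrarily chosen preimage under h0; by [sub], equality of the
     kernels makes the choice immaterial. *)
  pose a x := eval_hom h (xchoose (ex x)).
  have aE v : a (eval_hom h0 v) = eval_hom h v.
    by apply/sub/eqP; exact: (xchooseP (ex (eval_hom h0 v))).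
  have aD : {morph a : x y / x + y}.
    move=> x y; have [v <-] := onto0 x; have [w <-] := onto0 y.
    by rewrite -eval_homD !aE eval_homD.
  have a_inj : injective a.
    move=> x y; have [v <-] := onto0 x; have [w <-] := onto0 y.
    by rewrite !aE => /sub.
  exists (perm a_inj).
    rewrite inE; apply/andP; split; first by apply/subsetP => x; rewrite inE.
    by apply/morphicP => x y _ _; rewrite !permE aD.
  apply/rowP => i; rewrite mxE permE.
  by rewrite -[RHS]/(a (h0 0 i)) -(eval_hom_delta h0) aE eval_hom_delta.
have aD := AutD _ aA; split.
  apply/onto_homP => x; have [v vE] := onto0 (a^-1%g x).
  by exists v; rewrite homE // vE permKV.
rewrite ker0; apply/eqP/setP => v; rewrite !inE homE //.
have a0 : a 0 = 0 by apply: (addrI (a 0)); rewrite -aD !addr0.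
by rewrite -{2}a0 (inj_eq perm_inj).
Qed.

(** * Completing a left-invertible block to a presentation of H *)

Section LeftInvertible.
Variables (m N : nat).
Local Notation n := (m + N)%N.
Variables (A : 'M[Zq]_(n, m)) (C : 'M[Zq]_(m, n)).
Hypothesis CA : C *m A = 1%:M.

(* If A *m u lies in p L then u = C *m A *m u is divisible by p, so the columns
   of A stay independent in L / pL. *)
Lemma card_join_span_left_inv (L : {group 'cV[Zq]_n}) :
  (forall u, A *m u \in L) ->
  #|join_span (mulp_set L) A| = (p ^ m * #|mulp_set L|)%N.
Proof.
move=> AL; apply/eqP; rewrite eqn_leq; apply/andP; split.
  by apply: card_join_span_le => u; apply/imsetP; exists (A *m u).
rewrite -(card_digits m) mulnC -[#|{: _}|]cardsT -cardsX.
pose f (x : 'cV[Zq]_n * 'cV['I_p]_m) := x.1 + A *m of_digits x.2.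
rewrite -(@card_in_imset _ _ f).
  apply/subset_leq_card/subsetP => _ /imsetP[[l u] + ->].
  rewrite !inE andbT /= => Ll; apply/join_spanP.
  by exists l => //; exists (of_digits u).
move=> [a u] [a' u']; rewrite !inE !andbT /= => /imsetP[l _ ->] /imsetP[l' _ ->].
rewrite /f /= => /eqP; rewrite -subr_eq -addrA addrC eq_sym -subr_eq => /eqP E.
suff uu : u = u' by move: E; rewrite uu subrr => /eqP; rewrite subr_eq0 eq_sym => /eqP ->.
apply: (@of_digits_inj _ _ _ (C *m (l' - l))).
rewrite -[LHS]mul1mx -CA -mulmxA mulmxBr -(raddfMn (mulmx C)) /= mulrnBl.
by congr (_ *m _); rewrite -E.
Qed.

(** Let L be the kernel of h and D = pL + im A. Then |L / pL| = p^n and A contributes p^m, so L / D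
    has order p^N. [card_join_span_eq] counts the B that generate L over D, and Nakayama's lemma
    removes pL. *)
Lemma card_completions (h : 'rV[H]_n) :
  hmul h A = 0 ->
  #|[set B : 'M[Zq]_(n, N) | col_span (row_mx A B) == ker_hom h]| =
    (\prod_(i < N) (#|ker_hom h| - p ^ i * (#|ker_hom h| %/ p ^ N)))%N.
Proof.
move=> hA; have AL u : A *m u \in ker_hom h.
  by rewrite inE eval_hom_eq0 -hmulA hA hmul0l.
pose D := join_span_group (mulp_group (ker_hom_group h)) A.
have cD : #|ker_hom h| = (p ^ N * #|D|)%N.
  rewrite card_mulp_ker /= (card_join_span_left_inv (L := ker_hom_group h)) //=.
  by rewrite mulnA -expnD [(N + m)%N]addnC.
rewrite cD mulKn ?expn_gt0 ?p_gt0 // -cD -(@card_join_span_eq _ _ (ker_hom_group h) D).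
- apply: eq_card => B; rewrite !inE.
  by rewrite -(join_span_mulp (ker_hom_group h)) join_span_row_mx.
- apply/subsetP => _ /join_spanP[_ /imsetP[l Ll ->] [u ->]].
  by rewrite (groupDr (G := ker_hom_group h)) ?groupMnr.
- move=> v Lv; apply: (subsetP (sub_join_span _ _)); apply/imsetP.
  by exists v.
- exact: cD.
Qed.

Lemma rows_group_set k (G : {group H}) :
  group_set [set h : 'rV[H]_k | [forall i, h 0 i \in G]].
Proof.
apply: group_setr => [|x y]; rewrite !inE.
  by apply/forallP => i; rewrite mxE group0r.
move=> /forallP xG /forallP yG; apply/forallP => i.
by rewrite mxE groupDr.
Qed.

(** Composition with A maps G^n onto G^m, since g is the image of g C; its kernel therefore has
    |G|^n / |G|^m elements. *)
Lemma card_hom_vanishing (G : {group H}) :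
  #|[set h : 'rV[H]_n | [forall i, h 0 i \in G] & hmul h A == 0]| = (#|G| ^ N)%N.
Proof.
have hmulG k l (h : 'rV[H]_k) (B : 'M_(k, l)) :
    [forall i, h 0 i \in G] -> [forall i, hmul h B 0 i \in G].
  move=> /forallP hG; apply/forallP => j; rewrite mxE.
  by apply: group_sumr => i _; exact: groupMnr.
have := card_additive_image (Group (rows_group_set n G)) (hmulDl A).
rewrite [X in X = _]card_row_in expnD.
rewrite (_ : _ @: _ = [set h : 'rV[H]_m | [forall i, h 0 i \in G]]).
  rewrite card_row_in => /eqP; rewrite eqn_pmul2l ?expn_gt0 ?cardG_gt0 //.
  by move=> /eqP ->; apply: eq_card => h; rewrite !inE.
apply/setP => g; rewrite inE; apply/imsetP/idP => [[h + ->]|gG].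
  by rewrite inE; exact: hmulG.
exists (hmul g C); first by rewrite inE hmulG.
by rewrite hmulA CA hmul1.
Qed.

Lemma card_onto_hom_vanishing_ub :
  (#|[set h : 'rV[H]_n | onto_hom h & hmul h A == 0%R]| <= #|H| ^ N)%N.
Proof.
rewrite -cardsT -(card_hom_vanishing [set: H]%G); apply/subset_leq_card/subsetP => h.
by rewrite !inE => /andP[_ ->]; rewrite andbT; apply/forallP => i; rewrite inE.
Qed.

(** A homomorphism that is not onto takes values in a proper subgroup G, and |G|^N is at most (|H| /
    2)^N; a union bound over subgroups follows. The factor 2^N is cleared to stay in the
    naturals. *)
Lemma card_onto_hom_vanishing_lb :
  (2 ^ N * #|H| ^ N <= 2 ^ N * #|[set h : 'rV[H]_n | onto_hom h & hmul h A == 0%R]|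
     + #|{group H}| * #|H| ^ N)%N.
Proof.
have im_group (h : 'rV[H]_n) : group_set [set eval_hom h v | v in [set: 'cV_n]].
  apply: group_setr => [|_ _ /imsetP[v _ ->] /imsetP[w _ ->]]; apply/imsetP.
    by exists 0 => //; symmetry; apply/eqP; rewrite eval_hom_eq0 hmul0r.
  by exists (v + w); rewrite // eval_homD.
pose bad := \bigcup_(G : {group H} | G != [set: H] :> {set H})
  [set h : 'rV[H]_n | [forall i, h 0 i \in G] & hmul h A == 0].
have tot : (#|H| ^ N <= #|[set h : 'rV[H]_n | onto_hom h & hmul h A == 0%R]| + #|bad|)%N.
  rewrite -{1}cardsT -(card_hom_vanishing [set: H]%G).
  apply: leq_trans (leq_card_setU _ _); apply/subset_leq_card/subsetP => h.
  rewrite !inE => /andP[_ hA]; rewrite hA andbT.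
  case: (boolP (onto_hom h)) => //= honto; apply/bigcupP.
  exists (Group (im_group h)) => /=.
    apply: contra honto => /eqP imT; apply/onto_homP => x.
    have : x \in [set: H] by [].
    by rewrite -imT => /imsetP[v _ ->]; exists v.
  rewrite inE hA andbT; apply/forallP => i; apply/imsetP.
  by exists (delta_mx i 0); rewrite ?inE ?eval_hom_delta.
apply: leq_trans (leq_mul (leqnn _) tot) _; rewrite mulnDr leq_add2l.
apply: leq_trans (leq_mul (leqnn _) (card_bigcup_le _ _)) _.
rewrite big_distrr /= -sum_nat_const.
apply: (@leq_trans (\sum_(G : {group H} | G != [set: H] :> {set H}) #|H| ^ N)).
  apply: leq_sum => G GT; rewrite card_hom_vanishing -expnMn.
  case: N => // k; rewrite leq_exp2r //; exact: double_card_proper.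
by rewrite [X in (_ <= X)%N](bigID (fun G : {group H} => G != [set: H] :> {set H})) leq_addr.
Qed.

(** Double counting of the pairs (h, B). The number of completions is the same for all h because
    every kernel has order q^n / |H|. *)
Lemma card_has_presentation :
  (#|Aut [set: H]| * #|[set B : 'M[Zq]_(n, N) | presentations (row_mx A B) != set0]| =
   #|[set h : 'rV[H]_n | onto_hom h & hmul h A == 0%R]| *
   \prod_(i < N) (q ^ n %/ #|H| - p ^ i * (q ^ n %/ #|H| %/ p ^ N)))%N.
Proof.
rewrite mulnC -sum_nat_const -[RHS]sum_nat_const.
transitivity (\sum_(B : 'M[Zq]_(n, N)) #|presentations (row_mx A B)|)%N.
  rewrite big_mkcond; apply: eq_bigr => B _; rewrite inE.
  have [->|/set0Pn[h hB]] := eqVneq; first by rewrite cards0.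
  by rewrite (card_presentations hB).
transitivity (\sum_(B : 'M[Zq]_(n, N)) \sum_(h : 'rV[H]_n)
    (onto_hom h && (col_span (row_mx A B) == ker_hom h)))%N.
  apply: eq_bigr => B _; rewrite -sum1_card big_mkcond; apply: eq_bigr => h _.
  by rewrite inE; case: (_ && _).
rewrite exchange_big [RHS]big_mkcond; apply: eq_bigr => h _; rewrite inE /=.
case: (boolP (onto_hom h)) => /= [onto_h|_]; last by rewrite big1.
case: eqP => [hA|hA].
  have H_gt0 : (0 < #|H|)%N by apply/card_gt0P; exists 0.
  rewrite -(card_ker_hom onto_h) mulKn // -(card_completions hA) -sum1_card [RHS]big_mkcond.
  by apply: eq_bigr => B _; rewrite inE; case: eqP.
(* If h does not kill A, no B contributes: the columns of A lie in the span, which would be the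
   kernel of h. *)
rewrite big1 // => B _; case: eqP => // E; case: hA.
apply/rowP => j; rewrite [RHS]mxE.
have : row_mx A B *m delta_mx (lshift N j) 0 \in ker_hom h.
  by rewrite -E; apply/col_spanP; exists (delta_mx (lshift N j) 0).
rewrite inE eval_hom_eq0 -hmulA hmul_row_mx => /eqP /rowP /(_ 0).
have := eval_hom_delta (row_mx (hmul h A) (hmul h B)) (lshift N j).
by rewrite /eval_hom row_mxEl => -> ->; rewrite mxE.
Qed.

End LeftInvertible.

End Action.

End ModPrimePower.

From mathcomp Require Import all_classical all_reals all_analysis.
From mathcomp Require Import ring lra zify.
Import numFieldNormedType.Exports.
Local Open Scope classical_set_scope.

(** * Cokernels of p-adic matrices and their reductions *)

Section Padic.
Variable p : nat.
Hypothesis p_pr : prime p.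
Implicit Types x y : padic p.

Let p_gt1 : (1 < p)%N := prime_gt1 p_pr.
Let p_gt0 : (0 < p)%N := prime_gt0 p_pr.

Definition padic_proj k (x : padic p) : 'Z_(p ^ k.+1) := x k.

Lemma padic_proj_is_zmod_morphism k : zmod_morphism (padic_proj k).
Proof. by []. Qed.
Lemma padic_proj_is_monoid_morphism k : monoid_morphism (padic_proj k).
Proof. by []. Qed.

HB.instance Definition _ k := GRing.isZmodMorphism.Build (padic p) _
  (padic_proj k) (padic_proj_is_zmod_morphism k).
HB.instance Definition _ k := GRing.isMonoidMorphism.Build (padic p) _
  (padic_proj k) (padic_proj_is_monoid_morphism k).

Lemma residueMn x m k : (x *+ m) k = x k *+ m.
Proof. exact: (raddfMn (padic_proj k)). Qed.

Lemma val_Zpk_nat k m : ((m%:R : 'Z_(p ^ k.+1)) : nat) = (m %% p ^ k.+1)%N.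
Proof. exact: (val_Zp_nat (modulus_gt1 k p_pr)). Qed.

Lemma residue_le x j k : (j <= k)%N -> (x j : nat) = (x k %% p ^ j.+1)%N.
Proof.
elim: k => [|k IH].
  by rewrite leqn0 => /eqP ->; rewrite -val_Zpk_nat natr_Zp.
rewrite leq_eqVlt => /orP[/eqP ->|jk]; first by rewrite -val_Zpk_nat natr_Zp.
by rewrite IH // -(residue_compat x k) val_Zpk_nat modn_dvdm ?dvdn_exp2l.
Qed.

(** Division by p^(e+1) costs e+1 levels: the k-th residue of the quotient is read off from residue
    k+e+1 of x. *)
Lemma padic_dvd_compat x e k :
  ((((x (k.+1 + e.+1)%N %/ p ^ e.+1)%N%:R : 'Z_(p ^ k.+2)) : nat)%:R : 'Z_(p ^ k.+1)) =
  (x (k + e.+1)%N %/ p ^ e.+1)%N%:R.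
Proof.
apply: val_inj; rewrite /= !val_Zpk_nat modn_dvdm ?dvdn_exp2l //.
rewrite (residue_le x (leqnSn (k + e.+1))).
rewrite -[x (k.+1 + e.+1)%N]/(x (k + e.+1).+1); move: (x _ : nat) => a.
rewrite {1}(divn_eq a (p ^ (k + e.+1).+1)).
rewrite -addSn [X in (_ * X + _)%N]expnD mulnA divnMDl ?expn_gt0 ?p_gt0 //.
by rewrite modnMDl.
Qed.

Lemma padic_dvdP x e : x e = 0 -> exists y, x = y *+ (p ^ e.+1).
Proof.
move=> xe0; exists (Padic (padic_dvd_compat x e)); apply: padicP => k.
rewrite residueMn /= -mulrnA divnK.
  by apply: val_inj; rewrite /= val_Zpk_nat -residue_le // leq_addr.
by rewrite /dvdn -residue_le ?xe0 // addnS leqW // leq_addl.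
Qed.

Lemma residue_unit x k : x 0%N != 0 -> x k \is a GRing.unit.
Proof.
move=> x0; rewrite -(natr_Zp (x k)) unitZpE ?modulus_gt1 //.
rewrite coprime_pexpl // prime_coprime // /dvdn.
by rewrite -[X in (_ %% X)%N]expn1 -residue_le.
Qed.

Lemma padic_inv_compat x (x0 : x 0%N = 1) k :
  reduce ((x k.+1)^-1) = (x k)^-1.
Proof.
have Uj j : x j \is a GRing.unit by rewrite residue_unit // x0 oner_eq0.
apply: (mulrI (Uj k)); rewrite (divrr (Uj k)) -{1}(residue_compat x k) -/(reduce _).
by rewrite -reduceM (divrr (Uj _)) padic1_compat.
Qed.

(** Inverses are taken level by level. This will be applied to the determinant of 1 - p W. *)
Lemma padic_unit x : x 0%N = 1 -> exists y, x * y = 1.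
Proof.
move=> x0; exists (@Padic p (fun k => (x k)^-1) (padic_inv_compat x0)).
by apply: padicP => k; rewrite -[LHS]/(x k / x k) divrr ?residue_unit // x0 oner_eq0.
Qed.

Lemma map_residue_lift n m k (A : 'M['Z_(p ^ k.+1)]_(n, m)) :
  exists B : 'M[padic p]_(n, m), map_mx (padic_proj k) B = A.
Proof.
exists (map_mx (fun a : 'Z_(p ^ k.+1) => (a : nat)%:R) A).
by apply/matrixP => i j; rewrite !mxE rmorph_nat natr_Zp.
Qed.

Lemma map_residue_dvd n m k (A B : 'M[padic p]_(n, m)) :
  map_mx (padic_proj k) A = map_mx (padic_proj k) B ->
  exists C, A = B + C *+ (p ^ k.+1).
Proof.
move=> AB; have /choice[f fE] ij : exists y, (A - B) ij.1 ij.2 = y *+ (p ^ k.+1).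
  apply: padic_dvdP; rewrite !mxE.
  have /matrixP/(_ ij.1 ij.2) := AB; rewrite !mxE => E.
  by apply/eqP; rewrite subr_eq0; apply/eqP.
exists (\matrix_(i, j) f (i, j)); apply/matrixP => i j.
by rewrite mxE mulmxnE mxE -fE /= !mxE addrC subrK.
Qed.

(** * Cokernels over Z_p versus presentations modulo p^(e+1) *)

Section Bridge.
Variables (e : nat) (H : finZmodType).
Hypothesis H_torsion : forall x : H, x *+ (p ^ e) = 0.
Variables (n : nat) (Z : 'M[padic p]_n).
Local Notation red := (map_mx (padic_proj e)).

Lemma torsion_expS (x : H) : x *+ (p ^ e.+1) = 0.
Proof. by rewrite expnSr mulrnA H_torsion mul0rn. Qed.

(** The projection from Z_p^n to the cokernel, followed by the isomorphism, kills p^(e+1) Z_p^n and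
    thus factors through (Z/q)^n; the factor is the presentation. *)
Lemma presentation_of_cok :
  zmod_isog (cok Z) H -> presentations H (red Z) != finset.set0.
Proof.
move=> [f [g gf fg]].
pose psi (v : 'cV[padic p]_n) : H := f (\pi_(cok Z)%qT v).
have psiD : {morph psi : v w / v + w} by move=> v w; rewrite /psi !raddfD.
have psi0 : psi 0 = 0 by apply: (addrI (psi 0)); rewrite -psiD !addr0.
have psiMn v k : psi (v *+ k) = psi v *+ k.
  by elim: k => [|k IH]; rewrite ?mulr0n // !mulrS psiD IH.
have ker_psi v : psi v = 0 <-> exists u, v = Z *m u.
  have -> : (psi v = 0) <-> (v \in col_image Z).
    rewrite -[v]subr0 Quotient.idealrBE subr0; split=> [v0|/eqP E].
      by apply/eqP/(can_inj gf); rewrite -/(psi v) -/(psi 0) v0 psi0.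
    by rewrite /psi E -/(psi 0).
  by split=> [/asboolP|?] //; apply/asboolP.
pose h : 'rV[H]_n := \row_i psi (delta_mx i 0).
(* v is the combination of basis vectors with the representatives of its residues as coefficients,
   up to a multiple of p^(e+1), which psi kills. *)
have psiE v : psi v = eval_hom h (red v).
  have [w vE] : exists w, v = \sum_i (delta_mx i 0) *+ (v i 0 e) + w *+ (p ^ e.+1).
    apply: map_residue_dvd; apply/colP => i; rewrite !mxE summxE rmorph_sum /=.
    rewrite (bigD1 i) //= big1 => [|k ki]; rewrite mulmxnE raddfMn mxE.
      by rewrite !eqxx rmorph1 addr0 natr_Zp.
    by rewrite eq_sym (negPf ki) raddf0 mul0rn.
  rewrite {1}vE psiD psiMn torsion_expS addr0 (big_morph psi psiD psi0).
  rewrite /eval_hom mxE; apply: eq_bigr => i _.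
  by rewrite psiMn !mxE.
apply/set0Pn; exists h; rewrite inE; apply/andP; split.
  apply/onto_homP => x; 
  exists (red (generic_quotient.repr (g x))); rewrite -psiE /psi reprK fg //.
apply/eqP/setP => v; have [w <-] := map_residue_lift v.
rewrite inE -psiE; apply/col_spanP/eqP => [[u uE]|/ker_psi[u ->]].
  have [u' u'E] := map_residue_lift u; rewrite -u'E -map_mxM in uE.
  by rewrite psiE uE -psiE; apply/ker_psi; exists u'.
by exists (red u); rewrite map_mxM.
Qed.

(** Composing h with reduction gives a surjection psi from Z_p^n whose kernel is im Z + p^(e+1)
    Z_p^n. As p^e already kills H, Nakayama's lemma shows that im Z contains p^e Z_p^n, so the
    kernel is im Z itself. *)
Lemma cok_of_presentation :
  presentations H (red Z) != finset.set0 -> zmod_isog (cok Z) H.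
Proof.
move=> /set0Pn[h]; rewrite inE => /andP[/onto_homP onto_h /eqP ker_h].
pose psi (v : 'cV[padic p]_n) : H := eval_hom h (red v).
have psiD : {morph psi : v w / v + w}.
  move=> v w; rewrite /psi -(eval_homD p_pr H_torsion); congr eval_hom.
  by apply/colP => i; rewrite !mxE.
have psi0 : psi 0 = 0 by apply: (addrI (psi 0)); rewrite -psiD !addr0.
have psiMn v k : psi (v *+ k) = psi v *+ k.
  by elim: k => [|k IH]; rewrite ?mulr0n // !mulrS psiD IH.
have ker_mod v : psi v = 0 -> exists u w, v = Z *m u + w *+ (p ^ e.+1).
  move=> v0; have : red v \in ker_hom p e h by rewrite inE; apply/eqP.
  rewrite -ker_h => /col_spanP[u]; have [u' <-] := map_residue_lift u.
  by rewrite -map_mxM => /map_residue_dvd[w ->]; exists u', w.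
(* Nakayama: p^e lies in im Z + p^(e+1), so p^e (1 - p W) = Z U', and
   1 - p W is invertible. *)
have [U UE] : exists U, (p ^ e)%:R%:M = Z *m U.
  have /choice[uw uwE] (i : 'I_n) : exists uw : 'cV[padic p]_n * 'cV[padic p]_n,
      (delta_mx i 0 : 'cV[padic p]_n) *+ (p ^ e) = Z *m uw.1 + uw.2 *+ (p ^ e.+1).
    have [|u [w uw]] := ker_mod (delta_mx i 0 *+ (p ^ e)).
      by rewrite psiMn H_torsion.
    by exists (u, w).
  pose U := \matrix_(i, j) (uw j).1 i 0; pose W := \matrix_(i, j) (uw j).2 i 0.
  have EUW : (p ^ e)%:R%:M = Z *m U + W *+ (p ^ e.+1).
    apply/matrixP => i j; have /colP/(_ i) := uwE j.
    rewrite !(mxE, mulmxnE) eqxx andbT -mulrnA.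
    rewrite [in X in X = _]mulnC mulrnA => ->; congr (_ + _).
    by apply: eq_bigr => k _; rewrite mxE.
  pose Q := 1%:M - W *+ p.
  have EQ : (p ^ e)%:R *: Q = Z *m U.
    rewrite scalerBr scale_scalar_mx mulr1 EUW scaler_nat -mulrnA -expnS.
    by rewrite addrK.
  have [d dE] : exists d, \det Q * d = 1.
    apply: padic_unit; rewrite -/(padic_proj 0 _) -det_map_mx map_mxB map_mx1.
    rewrite (_ : map_mx _ (W *+ p) = 0) ?subr0 ?det1 //.
    apply/matrixP => i j; rewrite !mxE mulmxnE raddfMn /= -mulr_natr.
    by rewrite -[p in p%:R]expn1 (Zq_char 0 p_pr) mulr0.
  exists (U *m (d *: \adj Q)).
  rewrite mulmxA -EQ -scalemxAl -scalemxAr mul_mx_adj scale_scalar_mx.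
  by rewrite mulrC dE scale_scalar_mx mulr1.
have ker_psi v : psi v = 0 <-> v \in col_image Z.
  split=> [/ker_mod[u [w ->]]|/asboolP[u ->]].
    apply/asboolP; exists (u + U *m w *+ p).
    rewrite mulmxDr (raddfMn (mulmx Z)) /= mulmxA -UE mul_scalar_mx scaler_nat.
    by rewrite -mulrnA -expnSr.
  apply/eqP; rewrite -[_ == _]/(_) /psi map_mxM.
  have : red Z *m red u \in ker_hom p e h by rewrite -ker_h; apply/col_spanP; exists (red u).
  by rewrite inE.
(* The induced map is defined on representatives; [fE] shows that they do not matter, as ker psi =
   im Z. *)
pose f (x : cok Z) : H := psi (generic_quotient.repr x).
have psiB v w : psi (v - w) = psi v - psi w.
  by apply/eqP; rewrite eq_sym subr_eq -psiD subrK.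
have fE v : f (\pi_(cok Z)%qT v) = psi v.
  apply/eqP; rewrite -subr_eq0 -psiB; apply/eqP/ker_psi.
  by rewrite Quotient.idealrBE reprK.
have f_add : zmod_morphism f.
  move=> x y; rewrite -[x]reprK -[y]reprK -raddfB !fE; exact: psiB.
pose F : {additive cok Z -> H} := HB.pack f (GRing.isZmodMorphism.Build _ _ f f_add).
have f_surj (x : H) : exists y : cok Z, f y = x.
  have [v <-] := onto_h x; have [w wE] := map_residue_lift v.
  by exists (\pi_(cok Z)%qT w); rewrite fE /psi wE.
have /choice[g gE] := f_surj.
have f_inj : injective f.
  move=> x y /eqP; rewrite -subr_eq0 -f_add -[x]reprK -[y]reprK -raddfB fE.
  by move=> /eqP/ker_psi; rewrite Quotient.idealrBE => /eqP.
exists F, g => x; last exact: gE.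
by apply: f_inj; rewrite gE.
Qed.

End Bridge.
End Padic.

(** * The law of a random matrix modulo a power of p *)

Lemma measurable_padic_open p (A : set (padic p)) : padic_open A -> measurable A.
Proof. by move=> oA; apply: sub_sigma_algebra; exact: oA. Qed.

Lemma measurable_padic_ball p k (a : 'Z_(p ^ k.+1)) :
  measurable [set x : padic p | x k = a].
Proof.
by apply: measurable_padic_open => x /= xa; exists k => y yx /=; rewrite yx.
Qed.

Lemma measurable_padic_zero p : measurable [set (0 : padic p)].
Proof.
rewrite -[X in measurable X]setCK; apply: measurableC.
apply: measurable_padic_open => x /= x0.
have [k xk] : exists k, x k <> 0.
  apply/existsNP => xk; apply: x0; apply: padicP => k; exact: xk.
by exists k => y yx y0; apply: xk; rewrite -yx y0.
Qed.

Section Probability.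
Context (R : realType) (d : measure_display) (T : measurableType d)
  (P : probability T R).

Lemma measure_finite_partition (F : finType) (g : T -> F) (S : {set F}) :
  (forall x, measurable (g @^-1` [set x])) ->
  measurable [set w | g w \in S] /\
  P [set w | g w \in S] = (\sum_(x in S) P (g @^-1` [set x]))%E.
Proof.
move=> mg; rewrite -big_enum /=.
have -> : [set w | g w \in S] = [set w | g w \in enum S].
  by apply/seteqP; split=> w /=; rewrite mem_enum.
elim: (enum S) (enum_uniq S) => [|x s IH] /=.
  have -> : [set w | g w \in [::]] = set0 by apply/seteqP; split.
  by rewrite big_nil measure0.
move=> /andP[xs /IH[ms Es]].
have -> : [set w | g w \in x :: s] = g @^-1` [set x] `|` [set w | g w \in s].
  apply/seteqP; split=> w /=; rewrite inE.
    by move=> /orP[/eqP|]; [left|right].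
  by move=> [->|ws]; rewrite ?eqxx // ws orbT.
split; first exact: measurableU.
rewrite big_cons -Es; apply: measureU => //.
by apply/seteqP; split=> w //= [-> ]; rewrite (negPf xs).
Qed.

Section Matrices.
Variables (p : nat).
Hypothesis p_pr : prime p.

Lemma measurable_residue_fiber n (X : T -> 'M[padic p]_n) k M :
  (forall i j, measurable_fun setT (fun w => X w i j)) ->
  measurable ((fun w => map_mx (padic_proj k) (X w)) @^-1` [set M]).
Proof.
move=> mX.
rewrite (_ : _ @^-1` _ = \bigcap_(ij in setT)
  ((fun w => X w ij.1 ij.2) @^-1` [set x : padic p | x k = M ij.1 ij.2])).
  apply: fin_bigcap_measurable => [|ij _]; first exact: finite_finset.
  by rewrite -[X in measurable X]setTI; apply: mX => //; exact: measurable_padic_ball.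
apply/seteqP; split=> [w <- [i j] _ /=|w XM]; first by rewrite mxE.
by apply/matrixP => i j; rewrite mxE; exact: (XM (i, j)).
Qed.

(** The p^(k+1) residue balls are translates of one another, so they share the total mass
    equally. *)
Lemma haar_ball (X : T -> padic p) k (a : 'Z_(p ^ k.+1)) :
  measurable_fun setT X -> haar_distributed P X ->
  P (X @^-1` [set x : padic p | x k = a]) = (p%:R ^- k.+1)%:E.
Proof.
move=> mX [_ X_inv].
have mB b : measurable (X @^-1` [set x : padic p | x k = b]).
  by rewrite -[X in measurable X]setTI; apply: mX => //; exact: measurable_padic_ball.
have ballE (b : 'Z_(p ^ k.+1)) :
    P (X @^-1` [set x : padic p | x k = b]) = P (X @^-1` [set x : padic p | x k = 0]).
  rewrite -[RHS](X_inv (b : nat)%:R _ (measurable_padic_ball (0 : 'Z_(p ^ k.+1)))).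
  congr (P (X @^-1` _)); apply/seteqP; split=> [x /= xb|_ [x /= x0 <-]].
    exists (x - (b : nat)%:R); last by rewrite addrC subrK.
    rewrite -[LHS]/(padic_proj k _) rmorphB /= rmorph_nat natr_Zp.
    by rewrite /padic_proj xb subrr.
  by rewrite -[LHS]/(padic_proj k _) rmorphD /= rmorph_nat natr_Zp /padic_proj x0 addr0.
have [_] := @measure_finite_partition _ (fun w => X w k) [set: 'Z_(p ^ k.+1)]%SET mB.
rewrite (_ : [set _ | _] = setT) ?probability_setT; last first.
  by apply/seteqP; split=> w //= _; rewrite inE.
under eq_bigr => b _ do rewrite ballE.
have fin0 : P (X @^-1` [set x : padic p | x k = 0]) \is a fin_num.
  exact: fin_num_measure.
rewrite ballE -(fineK fin0) sumEFin sumr_const => E.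
congr EFin; case: E; rewrite cardsT card_Zq // => /esym.
have q0 : ((p ^ k.+1)%N%:R : R) != 0 by rewrite pnatr_eq0 -lt0n expn_gt0 prime_gt0.
by move=> E; apply: (mulIf q0); rewrite mulr_natr E natrX mulVf // -natrX.
Qed.

(** * Residues of a Haar matrix *)

Section Haar.
Variables (n : nat) (Sigma : n.-tuple {set 'I_n}) (X : T -> 'M[padic p]_n).
Hypothesis haarX : haar_matrix_on P Sigma X.

Definition supported (F : zmodType) (M : 'M[F]_n) :=
  [forall i, forall j, (i \in tnth Sigma j) || (M i j == 0)].

(** The residues of the entries on the support are independent and uniform, so the residue of the
    matrix is uniform among the supported ones. *)
Lemma haar_residue_fiber k (M : 'M['Z_(p ^ k.+1)]_n) :
  P ((fun w => map_mx (padic_proj k) (X w)) @^-1` [set M]) =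
  (if supported M then (p%:R ^- k.+1) ^+ #|support_set Sigma| else 0)%:E.
Proof.
have [mX X0 hX iX] := haarX.
case: ifPn => [/forallP sM|nsM]; last first.
  rewrite (_ : _ @^-1` _ = set0) ?measure0 //; apply/seteqP; split=> w //= wM.
  move: nsM; rewrite negb_forall => /existsP[i]; rewrite negb_forall => /existsP[j].
  rewrite negb_or => /andP[ij].
  by rewrite -wM mxE X0 // raddf0.
rewrite (_ : _ @^-1` _ = \bigcap_(ij in [set` support_set Sigma])
  ((fun w => X w ij.1 ij.2) @^-1` [set x : padic p | x k = M ij.1 ij.2])); last first.
  apply/seteqP; split=> [w <- [i j] _ /=|w XM]; first by rewrite mxE.
  apply/matrixP => i j; rewrite mxE.
  have [ij|ij] := boolP (i \in tnth Sigma j).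
    by apply: (XM (i, j)); rewrite /= inE.
  have /forallP/(_ j) := sM i; rewrite (negPf ij) /= => /eqP ->.
  by rewrite X0 // raddf0.
rewrite (iX _ (fun ij => [set x : padic p | x k = M ij.1 ij.2])) //; last first.
  by move=> ij; exact: measurable_padic_ball.
rewrite (eq_bigr (fun=> (p%:R ^- k.+1)%:E)) => [|[i j]].
  by rewrite prodEFin prodr_const.
by rewrite inE /= => ij; apply: haar_ball => //; exact: hX.
Qed.

Lemma haar_residue_prob k (S : {set 'M['Z_(p ^ k.+1)]_n}) :
  measurable [set w | map_mx (padic_proj k) (X w) \in S] /\
  P [set w | map_mx (padic_proj k) (X w) \in S] =
  (#|[set M in S | supported M]%SET|%:R * (p%:R ^- k.+1) ^+ #|support_set Sigma|)%:E.
Proof.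
have [mX X0 hX iX] := haarX.
have [mS ->] := measure_finite_partition S (fun M => @measurable_residue_fiber n X k M mX).
split=> //; under eq_bigr => M _ do rewrite haar_residue_fiber.
rewrite sumEFin -big_mkcondr /= mulr_natl -sumr_const; congr EFin.
by apply: eq_bigl => M; rewrite inE.
Qed.

Lemma haar_column_zero j :
  P (\bigcap_(i in [set` tnth Sigma j]) [set w | X w i j 0%N = 0]) =
  (p%:R ^- #|tnth Sigma j|)%:E.
Proof.
have [mX X0 hX iX] := haarX.
pose K := [set (i, j) | i in tnth Sigma j]%SET.
have -> : \bigcap_(i in [set` tnth Sigma j]) [set w | X w i j 0%N = 0] =
    \bigcap_(ij in [set` K]) ((fun w => X w ij.1 ij.2) @^-1` [set x : padic p | x 0%N = 0]).
  apply/seteqP; split=> w /= wE.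
    by move=> _ /= /imsetP[i ij ->]; exact: wE.
  by move=> i ij; apply: (wE (i, j)); apply: imset_f.
rewrite (iX _ (fun=> [set x : padic p | x 0%N = 0])); last 2 first.
- by apply/fintype.subsetP => _ /imsetP[i ij ->]; rewrite inE.
- by move=> _; exact: measurable_padic_ball.
rewrite (eq_bigr (fun=> (p%:R^-1)%:E)) => [|_ /imsetP[i ij ->]].
  rewrite prodEFin prodr_const card_imset ?exprVn //.
  by move=> i i' [].
rewrite haar_ball ?expr1 //; exact: hX.
Qed.

End Haar.

(** This also yields measurability of the event: it is a finite union of residue classes. *)
Lemma cok_isog_residue n (X : T -> 'M[padic p]_n) (H : finZmodType) e :
  (forall x : H, x *+ (p ^ e) = 0) ->
  [set w | zmod_isog (cok (X w)) H] =
  [set w | map_mx (padic_proj e) (X w) \in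
     [set M : 'M['Z_(p ^ e.+1)]_n | presentations H M != finset.set0]%SET].
Proof.
move=> H_torsion; apply/seteqP; split=> w /=; rewrite inE.
  exact: presentation_of_cok.
exact: cok_of_presentation.
Qed.

(** * Zero columns of a Bernoulli matrix *)

Section Bernoulli.
Variables (n k : nat) (Sigma : n.-tuple {set 'I_n}) (Y : T -> 'M[padic p]_n).
Variable eps : R.
Hypothesis berY : bernoulli_matrix_on P Sigma eps Y.

Let column_event (A B : seq 'I_n) : set T :=
  [set w | (forall j, j \in A -> exists2 i, i \in tnth Sigma j & Y w i j <> 0) /\
           (forall j, j \in B -> forall i, i \in tnth Sigma j -> Y w i j = 0)].

(** Independence applies directly to vanishing columns (A empty), where every entry is constrained
    separately. The non-vanishing ones are added by complementation: the event for j :: A and B is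
    the event for A and B minus the event for A and j :: B. This is why B is carried along. *)
Lemma prob_column_event (A B : seq 'I_n) :
  uniq (A ++ B) -> (forall j, j \in A ++ B -> #|tnth Sigma j| = k) ->
  measurable (column_event A B) /\
  P (column_event A B) =
    ((1 - (1 - eps) ^+ k) ^+ size A * ((1 - eps) ^+ k) ^+ size B)%:E.
Proof.
have [mY Y0 bY iY] := berY.
elim: A B => [|j A IH] B /=.
  move=> uB cB; pose K := [set ij : 'I_n * 'I_n |
    (ij.2 \in B) && (ij.1 \in tnth Sigma ij.2)]%SET.
  have -> : column_event [::] B =
      \bigcap_(ij in [set` K]) ((fun w => Y w ij.1 ij.2) @^-1` [set 0]).
    apply/seteqP; split=> w /= wE.
      by move=> [i j]; rewrite /= inE /= => /andP[jB ij]; apply: wE.2.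
    by split=> // j jB i ij; apply: (wE (i, j)); rewrite /= inE /= jB.
  have m0 ij : measurable ((fun w => Y w ij.1 ij.2) @^-1` [set 0]).
    by rewrite -[X in measurable X]setTI; apply: mY => //; exact: measurable_padic_zero.
  split; first by apply: fin_bigcap_measurable => // ; exact: finite_finset.
  rewrite (iY _ (fun=> [set 0])); last 2 first.
  - by apply/fintype.subsetP => ij; rewrite !inE => /andP[].
  - by move=> _; exact: measurable_padic_zero.
  rewrite (eq_bigr (fun=> (1 - eps)%:E)) => [|[i j]]; last first.
    by rewrite inE /= => /andP[_ /bY[]].
  rewrite prodEFin expr0 mul1r; congr EFin.
  rewrite prodr_const -exprM; congr (_ ^+ _).
  rewrite -sum1_card (eq_bigl (fun ij : 'I_n * 'I_n =>
    (ij.2 \in B) && (ij.1 \in tnth Sigma ij.2))); last first.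
    by move=> ij; rewrite inE.
  rewrite -(pair_big_dep predT (fun i j =>
    (j \in B) && (i \in tnth Sigma j)) (fun _ _ => 1%N)) /=.
  rewrite (exchange_big_dep (mem B)) /=; last by move=> i j _ /andP[].
  rewrite (eq_bigr (fun=> k)) => [|j jB]; last first.
    by rewrite -(cB j jB) -sum1_card; apply: eq_bigl => i; rewrite jB.
  rewrite sum_nat_const mulnC; congr (_ * _)%N.
  by rewrite -(card_uniqP uB); apply: eq_card.
move=> /andP[jAB uAB] cAB.
have [mAB PAB] := IH B uAB (fun i iAB => cAB i (mem_behead (s := j :: _) iAB)).
have perm_jB : perm_eq (A ++ j :: B) (j :: A ++ B) by rewrite -[j :: B]cat1s perm_catCA.
have [||mAjB PAjB] := IH (j :: B).
- by rewrite (perm_uniq perm_jB) /= jAB.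
- by move=> i; rewrite (perm_mem perm_jB); exact: cAB.
have -> : column_event (j :: A) B = column_event A B `\` column_event A (j :: B).
  apply/seteqP; split=> w [].
    move=> wA wB; split; first by split=> // i iA; apply: wA; rewrite inE iA orbT.
    move=> [_ /(_ j (mem_head _ _)) wj].
    by have [i ij] := wA j (mem_head _ _); apply; exact: wj.
  move=> [wA wB] wN; split=> // i; rewrite inE => /predU1P[->|iA]; last exact: wA.
  apply: contrapT => wj; apply: wN; split=> // l; rewrite inE => /predU1P[->|lB]; last exact: wB.
  by move=> t tj; apply: contrapT => ytj; apply: wj; exists t.
split; first exact: measurableD.
have -> : P (column_event A B `\` column_event A (j :: B)) =
    (P (column_event A B) - P (column_event A B `&` column_event A (j :: B)))%E.
  by apply: measureD => //; rewrite ltey_eq fin_num_measure.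
rewrite (_ : _ `&` _ = column_event A (j :: B)); last first.
  apply/seteqP; split=> w; first by case.
  move=> [wA wB]; split; last by split.
  by split=> // i iB; apply: wB; rewrite inE iB orbT.
rewrite PAB PAjB -EFinB; congr EFin.
by rewrite /= !exprS; ring.
Qed.

(** If the cokernel is trivial, preimages of the basis vectors form a right inverse, so the
    determinant is a unit and no column of A can vanish. *)
Lemma prob_trivial_cok (A : seq 'I_n) :
  uniq A -> (forall j, j \in A -> #|tnth Sigma j| = k) ->
  (P [set w | zmod_isog (cok (Y w)) 'I_1] <= ((1 - (1 - eps) ^+ k) ^+ size A)%:E)%E.
Proof.
move=> uA cA; have [mY _ _ _] := berY.
have [||mE PE] := @prob_column_event A [::]; rewrite ?cats0 //.
move: PE; rewrite expr0 mulr1 => <-.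
have tors (x : 'I_1) : x *+ (p ^ 0) = 0 by rewrite [LHS]ord1.
have mI : measurable [set w | zmod_isog (cok (Y w)) 'I_1].
  rewrite (cok_isog_residue _ tors).
  by have [] := measure_finite_partition
    [set M : 'M['Z_(p ^ 1)]_n | presentations 'I_1 M != finset.set0]%SET
    (fun M => @measurable_residue_fiber n Y 0 M mY).
apply: le_measure; rewrite ?inE //.
move=> w [f [g gf fg]]; split=> // j jA; apply: contrapT => noj.
have Yj i : Y w i j = 0.
  have [ij|ij] := boolP (i \in tnth Sigma j); last by have [_ Y0 _ _] := berY; exact: Y0.
  by apply: contrapT => yij; apply: noj; exists i.
have /choice[U UE] l : exists u : 'cV[padic p]_n, delta_mx l 0 = Y w *m u.
  suff /asboolP : (delta_mx l 0 : 'cV[padic p]_n) \in col_image (Y w) by [].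
  rewrite -[delta_mx l 0]subr0 Quotient.idealrBE; apply/eqP/(can_inj gf).
  by rewrite [LHS]ord1 [RHS]ord1.
have YU : Y w *m (\matrix_(i, l) U l i 0) = 1%:M.
  apply/matrixP => i l; have /colP/(_ i) := UE l; rewrite !mxE eqxx andbT => ->.
  by apply: eq_bigr => t _; rewrite mxE.
have := congr1 determinant YU; rewrite det_mulmx det1 (expand_det_col _ j) big1.
  by rewrite mul0r => /eqP; rewrite eq_sym oner_eq0.
by move=> i _; rewrite Yj mul0r.
Qed.

End Bernoulli.
End Matrices.
End Probability.

(** * The Haar case *)

(** The probability that a uniform N by N matrix over F_p is invertible; [CL_prob] uses its
    limit. *)
Definition euler_prod (R : realType) (p N : nat) : R :=
  \prod_(1 <= i < N.+1) (1 - p%:R ^- i).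

Lemma euler_factor_bounds (R : realType) p i : prime p ->
  0 <= 1 - (p%:R ^- i : R) <= 1.
Proof.
move=> p_pr; have p1 : (1 : R) <= p%:R ^+ i by rewrite exprn_ege1 // ler1n prime_gt0.
have p0 := lt_le_trans ltr01 p1.
by rewrite subr_ge0 invf_le1 // p1 /= lerBlDr lerDl invr_ge0 ltW.
Qed.

Lemma euler_prod_bounds (R : realType) p N : prime p -> 0 <= euler_prod R p N <= 1.
Proof.
move=> p_pr; rewrite /euler_prod; elim/big_rec: _ => [|i x _ /andP[x0 x1]].
  by rewrite ler01 lexx.
have /andP[f0 f1] := euler_factor_bounds R i p_pr.
by rewrite mulr_ge0 // mulr_ile1.
Qed.

(** With |L| = q^n / p^e, factor i is |L| (1 - p^-(N-i)). Multiplication by |H|^N, the approximate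
    number of h, turns |L|^N into the number q^(nN) of all B. *)
Lemma completions_euler_prod (R : realType) p e n N : prime p -> (N <= n)%N ->
  (\prod_(i < N) ((p ^ e.+1) ^ n %/ p ^ e -
      p ^ i * ((p ^ e.+1) ^ n %/ p ^ e %/ p ^ N)))%N%:R * ((p ^ e) ^ N)%N%:R
  = ((p ^ e.+1) ^ (n * N))%N%:R * euler_prod R p N.
Proof.
move=> p_pr; have p_gt0 := prime_gt0 p_pr.
have pR0 : (p%:R : R) != 0 by rewrite pnatr_eq0 -lt0n.
case: N => [|N] Nn; first by rewrite big_ord0 muln0 /euler_prod big_geq // mulr1.
(* p^t is the order of pL + im A. The empty product was treated apart because n may then be 0, where
   such a t need not exist. *)
have [t tE] : exists t, (e.+1 * n = t + e + N.+1)%N.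
  exists (e * n.-1 + (n - N.+1))%N; case: n Nn => // n Nn; rewrite /= mulSn mulnS; lia.
have -> : ((p ^ e.+1) ^ n %/ p ^ e = p ^ (t + N.+1))%N.
  by rewrite -expnM tE addnAC expnD mulnK ?expn_gt0 ?p_gt0.
have -> : (p ^ (t + N.+1) %/ p ^ N.+1 = p ^ t)%N by rewrite expnD mulnK ?expn_gt0 ?p_gt0.
have fE (i : 'I_N.+1) : ((p ^ (t + N.+1) - p ^ i * p ^ t)%N%:R : R) =
    p%:R ^+ (t + N.+1) * (1 - p%:R ^- (N.+1 - i)).
  rewrite natrB; last by rewrite -expnD leq_exp2l ?prime_gt1 // addnC leq_add2l ltnW.
  rewrite natrM !natrX mulrBr mulr1; congr (_ - _).
  apply: (canRL (mulfK (expf_neq0 _ pR0))); rewrite -!exprD; congr (_ ^+ _).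
  by have := ltn_ord i; lia.
rewrite natr_prod (eq_bigr _ (fun i _ => fE i)) big_split /= prodr_const card_ord.
rewrite /euler_prod big_add1 /= big_mkord [in RHS](reindex_inj rev_ord_inj) /=.
have -> : \prod_(i < N.+1) (1 - p%:R ^- (N.+1 - i)) =
    \prod_(i < N.+1) (1 - p%:R ^- (N.+1 - i.+1).+1) :> R.
  by apply: eq_bigr => i _; rewrite subnSK.
rewrite mulrAC; congr (_ * _); rewrite !natrX -!exprM -exprD; congr (_ ^+ _).
by rewrite mulnA tE -mulnDl addnAC.
Qed.

(** * The quantitative estimate for a fixed size *)

Section HaarEstimate.
Context (R : realType) (d : measure_display) (T : measurableType d)
  (P : probability T R).
Variables (p : nat) (m N k e : nat).
Hypothesis p_pr : prime p.
Local Notation n := (m + N)%N.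
Local Notation q := (p ^ e.+1)%N.
Local Notation Zq := 'Z_(p ^ e.+1).
Variables (Sigma : n.-tuple {set 'I_n}) (X : T -> 'M[padic p]_n).
Hypothesis haarX : haar_matrix_on P Sigma X.
Hypothesis disjoint_sparse : forall (j j' : 'I_m) i,
  i \in tnth Sigma (lshift N j) -> i \in tnth Sigma (lshift N j') -> j = j'.
Hypothesis card_sparse : forall j : 'I_m, #|tnth Sigma (lshift N j)| = k.
Hypothesis full_dense : forall j : 'I_N, tnth Sigma (rshift m j) = [set: 'I_n]%SET.
Variable H : finZmodType.
Hypothesis card_H : #|H| = (p ^ e)%N.

Let left_invertible (A : 'M[Zq]_(n, m)) := [exists C : 'M[Zq]_(m, n), C *m A == 1%:M].
Let good : {set 'M[Zq]_n} := [set M : 'M[Zq]_(n, m + N) | left_invertible (lsubmx M)]%SET.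

(** If each sparse column j has an entry that is a unit, say in row r j, then by disjointness row r
    j vanishes in the other sparse columns. Placing the inverse of that entry at (j, r j) gives a
    left inverse. *)
Lemma not_good_zero_column w : map_mx (padic_proj e) (X w) \notin good ->
  exists j : 'I_m, forall i, i \in tnth Sigma (lshift N j) -> X w i (lshift N j) 0%N = 0.
Proof.
apply: contraNP => /forallNP noj.
have /choice[r rE] (j : 'I_m) :
    exists i, i \in tnth Sigma (lshift N j) /\ X w i (lshift N j) 0%N != 0.
  have /existsNP[i /not_implyP[ij Xij]] := noj j; exists i; split=> //.
  exact/eqP.
rewrite inE; apply/existsP.
exists (\matrix_(j, i) if i == r j then (X w i (lshift N j) e)^-1 else 0).
apply/eqP/matrixP => j j'; rewrite !mxE (bigD1 (r j)) //= big1 => [|i ij]; last first.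
  by rewrite mxE (negPf ij) mul0r.
rewrite !mxE eqxx addr0; have [rj Xj] := rE j.
have [<-|jj'] := eqVneq j j'; first by rewrite /padic_proj mulVr // residue_unit.
have [_ X0 _ _] := haarX.
rewrite (X0 _ (lshift N j')); first by rewrite raddf0 mulr0.
by apply: contra_neqN jj'; exact: disjoint_sparse.
Qed.

Lemma prob_not_good :
  (P [set w | map_mx (padic_proj e) (X w) \in (~: good)%SET] <= (m%:R / p%:R ^+ k)%:E)%E.
Proof.
have [mX _ _ _] := haarX.
pose Z j := [set w | forall i, i \in tnth Sigma j -> X w i j 0%N = 0].
have ZE j : Z j = \bigcap_(i in [set` tnth Sigma j]) [set w | X w i j 0%N = 0] by [].
have mZ j : measurable (Z j).
  rewrite ZE; apply: fin_bigcap_measurable => [|i _]; first exact: finite_finset.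
  rewrite -[X in measurable X]setTI.
  exact: (mX i j measurableT _ (@measurable_padic_ball p 0 0)).
(* Boole's inequality is stated for sequences, so the events are extended by the empty set beyond
   m. *)
pose E (j : nat) := if insub j is Some j' then Z (lshift N (j' : 'I_m)) else set0.
have mE j : measurable (E j) by rewrite /E; case: insubP.
have [mG _] := haar_residue_prob p_pr haarX (~: good)%SET.
apply: (@le_trans _ _ (P (\big[setU/set0]_(j < m) E j))).
  apply: le_measure; rewrite ?inE //; first exact: bigsetU_measurable.
  move=> w /=; rewrite inE => /not_good_zero_column[j jE].
  by rewrite -bigcup_mkord; exists j => /=; rewrite ?ltn_ord // /E valK.
apply: le_trans (Boole_inequality _ _) _ => //.
rewrite (eq_bigr (fun=> (p%:R ^- k)%:E)) => [|j _].
  by rewrite sumEFin sumr_const card_ord mulr_natl.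
rewrite /E valK ZE -(card_sparse j); exact: haar_column_zero.
Qed.

Let H_torsion (x : H) : x *+ (p ^ e) = 0.
Proof. by rewrite -card_H mulrn_card. Qed.

Local Notation G := #|{group H}|.
Local Notation aut := #|Aut [set: H]%SET|.

(** In the exact count of [card_has_presentation], the number of surjections killing A lies between
    |H|^N (1 - G 2^-N) and |H|^N. *)
Lemma completions_bounds (A : 'M[Zq]_(n, m)) : left_invertible A ->
  let c := #|[set B : 'M[Zq]_(n, N) |
    presentations H (row_mx A B) != finset.set0]%SET|%:R : R in
  let t := (q ^ (n * N))%N%:R * euler_prod R p N in
  t * (1 - G%:R / 2 ^+ N) <= aut%:R * c <= t.
Proof.
move=> /existsP[C /eqP CA] /=.
set c := (X in aut%:R * X); set t := _ * euler_prod R p N.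
have := card_has_presentation p_pr H_torsion CA.
have := card_onto_hom_vanishing_lb p_pr H_torsion CA.
have := card_onto_hom_vanishing_ub p_pr H_torsion CA.
rewrite card_H; set h := #|_|; set pi := (\prod_(_ < _) _)%N => h_ub h_lb hE.
have tE := @completions_euler_prod R p e n N p_pr (leq_addl _ _); rewrite -/pi -/t in tE.
have -> : aut%:R * c = h%:R * pi%:R by rewrite -!natrM hE.
rewrite -tE [h%:R * _]mulrC -mulrA; apply/andP; split; rewrite ler_wpM2l //; last by rewrite ler_nat.
have h2 : (0 : R) < 2 ^+ N by rewrite exprn_gt0.
rewrite -(ler_pM2l h2) mulrCA mulrBr mulr1 mulrCA mulfV ?gt_eqF // mulr1.
have : ((2 ^ N * (p ^ e) ^ N)%N%:R : R) <=
    (2 ^ N * h + G * (p ^ e) ^ N)%N%:R by rewrite ler_nat.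
rewrite natrD !natrM [(2 ^ N)%N%:R]natrX mulrBr; lra.
Qed.

(** The dense columns are full, so the support only constrains the block A, and B ranges freely. [Q]
    will be taken both trivial and equal to the presentation condition. *)
Lemma card_supported_split (Q : pred 'M[Zq]_n) :
  #|[set M in [set M | Q M & M \in good] | supported Sigma M]%SET| =
  (\sum_(A : 'M[Zq]_(n, m) | left_invertible A &&
      [forall i, forall j, (i \in tnth Sigma (lshift N j)) || (A i j == 0%R)])
     #|[set B : 'M[Zq]_(n, N) | Q (row_mx A B)]%SET|)%N.
Proof.
rewrite -sum1_card big_mkcond /= sum_row_mx [RHS]big_mkcond /=; apply: eq_bigr => A _.
have sE (B : 'M[Zq]_(n, N)) : supported Sigma (row_mx A B) =
  [forall i, forall j, (i \in tnth Sigma (lshift N j)) || (A i j == 0%R)].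
  apply/forallP/forallP => sM i; apply/forallP => j.
    by have /forallP/(_ (lshift N j)) := sM i; rewrite row_mxEl.
  case: (split_ordP j) => l ->; last by rewrite full_dense inE.
  by have /forallP/(_ l) := sM i; rewrite row_mxEl.
case: ifP => [/andP[gA sA]|nA].
  rewrite -sum1_card [RHS]big_mkcond /=; apply: eq_bigr => B _.
  by rewrite !inE sE sA row_mxKl gA !andbT.
rewrite big1 // => B _; rewrite !inE sE row_mxKl -andbA nA andbF.
by [].
Qed.

Lemma haar_estimate : exists x : R,
  P [set w | zmod_isog (cok (X w)) H] = x%:E /\
  `|x - aut%:R^-1 * euler_prod R p N| <= m%:R / p%:R ^+ k + G%:R / 2 ^+ N.
Proof.
pose S := [set M : 'M[Zq]_n | presentations H M != finset.set0]%SET.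
pose u : R := (p%:R ^- e.+1) ^+ #|support_set Sigma|.
have prob S' := (haar_residue_prob p_pr haarX (S' : {set 'M[Zq]_n})).2.
rewrite (cok_isog_residue p_pr _ H_torsion) prob; eexists; split; first by [].
rewrite -/u -/S.
have sub (A B : {set 'M[Zq]_n}) : A \subset B ->
    (#|[set M in A | supported Sigma M]%SET| <= #|[set M in B | supported Sigma M]%SET|)%N.
  move=> /fintype.subsetP AB; apply/subset_leq_card/fintype.subsetP => M.
  by rewrite !inE => /andP[/AB ->].
have part (A : {set 'M[Zq]_n}) : #|[set M in A | supported Sigma M]%SET| =
    (#|[set M in A :&: good | supported Sigma M]%SET|
     + #|[set M in A :&: ~: good | supported Sigma M]%SET|)%N.
  rewrite -(cardsID good); congr (_ + _)%N; apply: eq_card => M; rewrite !inE.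
    by rewrite andbAC.
  by rewrite andbC andbAC andbC andbA.
have split_good (A : {set 'M[Zq]_n}) : #|[set M in A :&: good | supported Sigma M]%SET| =
    #|[set M in [set M | M \in A & M \in good] | supported Sigma M]%SET|.
  by apply: eq_card => M; rewrite !inE.
(* Numbers of supported residue matrices: [s] with cokernel H, [s'] those of them that are good, [g]
   all good ones, [b] all others. Each has mass [u]. *)
pose s := #|[set M in S | supported Sigma M]%SET|%:R : R.
pose s' := #|[set M in S :&: good | supported Sigma M]%SET|%:R : R.
pose g := #|[set M in [set: 'M[Zq]_n]%SET :&: good | supported Sigma M]%SET|%:R : R.
pose b := #|[set M in (~: good)%SET | supported Sigma M]%SET|%:R : R.
have u0 : 0 <= u by rewrite exprn_ge0 // invr_ge0 exprn_ge0.
have ss' : s' <= s by rewrite ler_nat sub // subsetIl.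
have sb : s <= s' + b by rewrite -natrD ler_nat (part S) leq_add2l sub // subsetIr.
have gb : (g + b) * u = 1.
  rewrite -natrD -[X in _ = X]/(fine 1%E) -(probability_setT P).
  have -> : [set: T] = [set w | map_mx (padic_proj e) (X w) \in [set: 'M[Zq]_n]%SET].
    by apply/seteqP; split=> w //= _; rewrite inE.
  by rewrite prob /= (part [set: _]%SET) (finset.setTI (~: good)%SET).
have bd : b * u <= m%:R / p%:R ^+ k.
  by rewrite -lee_fin -prob; exact: prob_not_good.
have aut_gt0 : (0 : R) < aut%:R by rewrite ltr0n cardG_gt0.
(* Summation of [completions_bounds] over all left-invertible supported blocks A. *)
have tg : aut%:R * s' <= g * euler_prod R p N /\
    g * euler_prod R p N * (1 - G%:R / 2 ^+ N) <= aut%:R * s'.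
  rewrite /s' /g !split_good !card_supported_split !natr_sum !mulr_sumr !mulr_suml.
  have cT (A : 'M[Zq]_(n, m)) : #|[set B : 'M[Zq]_(n, N) | row_mx A B \in [set: 'M[Zq]_n]%SET]%SET| =
      (q ^ (n * N))%N.
    transitivity #|{: 'M[Zq]_(n, N)}|; last by rewrite card_mx card_Zq.
    by apply: eq_card => B; rewrite !inE.
  have cS (A : 'M[Zq]_(n, m)) : #|[set B : 'M[Zq]_(n, N) | row_mx A B \in S]%SET| =
      #|[set B : 'M[Zq]_(n, N) | presentations H (row_mx A B) != finset.set0]%SET|.
    by apply: eq_card => B; rewrite !inE.
  split; apply: ler_sum => A /andP[gA _]; rewrite cT cS;
    by have /andP[] := completions_bounds gA.
have /andP[c0 c1] := euler_prod_bounds R N p_pr.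
have g0 : 0 <= g by exact: ler0n.
have b0 : 0 <= b by exact: ler0n.
have := tg.1; have := tg.2; move: aut_gt0; set al := aut%:R; set c := euler_prod R p N.
set ga : R := G%:R / 2 ^+ N.
have ga0 : 0 <= ga by rewrite divr_ge0 ?exprn_ge0.
have al1 : 1 <= al by rewrite ler1n cardG_gt0.
move=> al0 lo hi; pose w := al^-1 * c.
have w0 : 0 <= w by rewrite mulr_ge0 // invr_ge0 ltW.
have w1 : w <= 1 by rewrite mulr_ile1 // ?invr_ge0 ?(ltW al0) // invf_le1.
have {}hi : s' <= g * w by rewrite -(ler_pM2l al0) [al * (g * w)]mulrCA /w mulVKf ?gt_eqF.
have {}lo : g * w * (1 - ga) <= s'.
  by rewrite -(ler_pM2l al0) mulrA [al * (g * w)]mulrCA /w mulVKf ?gt_eqF.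
rewrite -/w -/s ler_distl.
have gu : g * u = 1 - b * u by rewrite -gb mulrDl addrK.
have gu1 : g * u <= 1 by rewrite gu gerBl mulr_ge0.
have hi' : s' * u <= g * u * w by rewrite mulrAC ler_wpM2r.
have lo' : g * u * w * (1 - ga) <= s' * u.
  by rewrite [g * u * w]mulrAC [_ * u * _]mulrAC ler_wpM2r.
have ss'u := ler_wpM2r u0 ss'; have sbu := ler_wpM2r u0 sb; rewrite mulrDl in sbu.
have guw : g * u * w <= w by rewrite ler_piMl.
have buw : b * u * w <= b * u by rewrite ler_piMr // mulr_ge0.
have guw0 : 0 <= g * u * w by rewrite (mulr_ge0 (mulr_ge0 g0 u0) w0).
have guwga : g * u * w * ga <= ga by rewrite ler_piMl // (le_trans guw).
have eguw : g * u * w = w - b * u * w by rewrite gu mulrBl mul1r.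
(* From above, s u <= s' u + b u <= w + b u. From below, s u >= g u w (1 - ga) >= w - b u - ga,
   since g u = 1 - b u. *)
apply/andP; split; move: lo'; rewrite mulrBr mulr1; lra.
Qed.

End HaarEstimate.

(** * Limits *)

Section EulerLimit.
Variables (R : realType) (p : nat).
Hypothesis p_pr : prime p.

Lemma euler_prodS N : euler_prod R p N.+1 = euler_prod R p N * (1 - p%:R ^- N.+1).
Proof. by rewrite /euler_prod big_nat_recr. Qed.

(** The bound 1/4 alone is not inductive. With x = 2^-(N+2) the next factor is at least 1 - x, and
    (1/4 + x) (1 - x) >= 1/4 + x/2 because x <= 1/4. *)
Lemma euler_prod_lb N : 4^-1 + 2^-1 ^+ N.+2 <= euler_prod R p N.+1.
Proof.
have p2 i : (p%:R ^- i : R) <= 2^-1 ^+ i.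
  by rewrite -exprVn lerXn2r ?nnegrE ?invr_ge0 // lef_pV2 ?posrE ?ltr0n ?prime_gt0 // ler_nat prime_gt1.
elim: N => [|N IH].
  rewrite /euler_prod big_nat1; have := p2 1%N; rewrite !expr1 !exprS expr0; lra.
rewrite euler_prodS; have /andP[f0 _] := euler_factor_bounds R N.+2 p_pr.
apply: le_trans (ler_wpM2r f0 IH).
have := p2 N.+2; set y := p%:R ^- _; set x := _ ^+ N.+2 => yx.
have x0 : 0 <= x by rewrite exprn_ge0 // invr_ge0.
have x1 : x <= 4^-1.
  have h : (2^-1 : R) ^+ N <= 1 by rewrite exprn_ile1 // ?invr_ge0 // invf_le1 // ler1n.
  rewrite /x !exprS; lra.
rewrite exprS -/x; nra.
Qed.

Lemma euler_prod_nonincreasing : nonincreasing_seq (euler_prod R p).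
Proof.
apply/nonincreasing_seqP => N; rewrite euler_prodS.
have /andP[f0 f1] := euler_factor_bounds R N.+1 p_pr.
by have /andP[e0 _] := euler_prod_bounds R N p_pr; rewrite ler_piMr.
Qed.

Lemma cvg_euler_prod : cvgn (euler_prod R p).
Proof.
apply: nonincreasing_is_cvgn; first exact: euler_prod_nonincreasing.
by exists 0 => _ [N _ <-]; have /andP[] := euler_prod_bounds R N p_pr.
Qed.

Lemma lim_euler_prod_gt0 : 0 < limn (euler_prod R p).
Proof.
apply: (@lt_le_trans _ _ 4^-1); first by rewrite invr_gt0.
apply: limr_ge; first exact: cvg_euler_prod.
exists 1%N => // N /= N1; case: N N1 => // N _.
by apply: le_trans (euler_prod_lb N); rewrite lerDl exprn_ge0 // invr_ge0.
Qed.

End EulerLimit.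

(** An algebraic substitute for (1 - x)^k <= exp(-k x): it tends to 0 as soon as k x tends to
    infinity. *)
Lemma one_sub_pow_le (R : realFieldType) (x : R) k :
  0 <= x <= 1 -> (1 - x) ^+ k * (1 + k%:R * x) <= 1.
Proof.
move=> /andP[x0 x1]; elim: k => [|k IH]; first by rewrite mul0r addr0 mulr1.
apply: le_trans IH; rewrite exprSr -mulrA ler_wpM2l ?exprn_ge0 ?subr_ge0 //.
have k0 : (0 : R) <= k%:R by exact: ler0n.
by rewrite -natr1; nra.
Qed.

(** * Choice of the supports *)

Section SupportChoice.
Variables (R : realType) (p : nat) (a : R).
Hypothesis p_pr : prime p.
Hypothesis a_bounds : p%:R^-1 < a < 1.

Let b : R := (a + p%:R^-1) / 2.

(* Between b^-k and b^-k + 1 for k > 0; the value 0 at k = 0 makes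
   block_size_fits hold even when no positive k qualifies. *)
Definition sparse_cols k : nat := if k is 0 then 0 else (Num.truncn (b ^- k)).+1.

Let p_gt0 : 0 < p%:R :> R. Proof. by rewrite ltr0n prime_gt0. Qed.
Let b_gt : p%:R^-1 < b. Proof. by rewrite /b; have := a_bounds; lra. Qed.
Let b_lt : b < a. Proof. by rewrite /b; have := a_bounds; lra. Qed.
Let b_gt0 : 0 < b.
Proof. by apply: lt_trans b_gt; rewrite invr_gt0. Qed.
Let a_gt0 : 0 < a. Proof. exact: lt_trans b_lt. Qed.

(** The second term pays for rounding b^-k up to an integer. The first ratio is below 1 because b >
    1/p. *)
Lemma sparse_cols_pow_p k :
  (sparse_cols k)%:R / p%:R ^+ k <= (b^-1 / p%:R) ^+ k + p%:R^-1 ^+ k :> R.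
Proof.
rewrite expr_div_n -[X in _ + X]mul1r [in X in _ + X]exprVn -mulrDl.
rewrite ler_wpM2r ?invr_ge0 ?exprn_ge0 ?(ltW p_gt0) // exprVn.
case: k => [|k]; first by rewrite /= expr0; lra.
by rewrite /sparse_cols -natr1 lerD2r truncn_le invr_ge0 exprn_ge0 // ltW.
Qed.

(** For k > 0 the number m of columns exceeds b^-k, hence m a^k >= (a / b)^k, and [one_sub_pow_le]
    applies with x = a^k. For k = 0 both sides are 1, the left one being 0^0. *)
Lemma sparse_cols_pow_a k : (1 - a ^+ k) ^+ sparse_cols k <= (b / a) ^+ k.
Proof.
case: k => [|k]; first by rewrite !expr0.
set m := sparse_cols _.
have x0 : 0 < a ^+ k.+1 by rewrite exprn_gt0.
have x1 : a ^+ k.+1 <= 1 by rewrite exprn_ile1 // ?ltW //; have /andP[] := a_bounds.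
have mx : (a / b) ^+ k.+1 <= m%:R * a ^+ k.+1.
  rewrite expr_div_n mulrC ler_wpM2r ?(ltW x0) // -exprVn.
  by rewrite exprVn ltW // truncnS_gt.
have y0 : 0 < (a / b) ^+ k.+1 by rewrite exprn_gt0 // divr_gt0.
have := @one_sub_pow_le _ (a ^+ k.+1) m; rewrite (ltW x0) x1 => /(_ isT) h.
rewrite -[b / a]invf_div exprVn -[X in _ <= X]mul1r ler_pdivlMr //.
apply: le_trans h; rewrite ler_wpM2l ?exprn_ge0 ?subr_ge0 //.
by rewrite (le_trans mx) // lerDr.
Qed.

(** The factor k + 1 instead of k leaves room for m disjoint blocks of size k and also for at least
    k dense columns. *)
Definition block_size n : nat :=
  \max_(k < n.+1 | (sparse_cols k * k.+1 <= n)%N) k.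

Lemma block_size_fits n : (sparse_cols (block_size n) * (block_size n).+1 <= n)%N.
Proof.
rewrite /block_size; apply: (big_ind (fun k => (sparse_cols k * k.+1 <= n)%N)) => //.
by move=> x y hx hy; rewrite /maxn; case: ifP.
Qed.

Definition num_sparse n := sparse_cols (block_size n).

Lemma blocks_fit n : (num_sparse n * block_size n <= n)%N.
Proof. by apply: leq_trans (block_size_fits n); rewrite leq_mul2l leqnSn orbT. Qed.

Lemma num_sparse_le n : (num_sparse n <= n)%N.
Proof. by apply: leq_trans (block_size_fits n); rewrite leq_pmulr. Qed.

Lemma block_size_le_dense n : (block_size n <= n - num_sparse n)%N.
Proof.
have := block_size_fits n; rewrite /num_sparse.
case: (block_size n) => // k; rewrite mulnS.
have : (0 < sparse_cols k.+1)%N by [].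
by move: (sparse_cols _) => s; nia.
Qed.

Lemma cvg_block_size : block_size n @[n --> \oo] --> \oo.
Proof.
apply/cvgnyPge => k; near=> n.
have kn : (k < n.+1)%N by rewrite ltnS; near: n; exact: nbhs_infty_ge.
rewrite /block_size.
apply: (@leq_bigmax_cond _ (fun k : 'I_n.+1 => sparse_cols k * k.+1 <= n)%N
  (fun k : 'I_n.+1 => k : nat) (Ordinal kn)).
by rewrite /=; near: n; exact: nbhs_infty_ge.
Unshelve. all: by end_near.
Qed.

Lemma cvg_dense : (n - num_sparse n)%N @[n --> \oo] --> \oo.
Proof.
apply/cvgnyPge => k; near=> n.
apply: leq_trans (block_size_le_dense n); near: n.
by move/cvgnyPge: cvg_block_size; apply.
Unshelve. all: by end_near.
Qed.

Definition sparse_support n : n.-tuple {set 'I_n} :=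
  [tuple if (j < num_sparse n)%N
         then [set i : 'I_n | (j * block_size n <= i < j * block_size n + block_size n)%N]%SET
         else [set: 'I_n]%SET | j < n].

Lemma card_sparse_support n (j : 'I_n) :
  (j < num_sparse n)%N -> #|tnth (sparse_support n) j| = block_size n.
Proof.
move=> jm; rewrite tnth_mktuple jm.
have lt (t : 'I_(block_size n)) : (j * block_size n + t < n)%N.
  move: (ltn_ord t) (blocks_fit n) jm; move: (nat_of_ord t) => {}t.
  by move: (block_size n) (num_sparse n); nia.
pose f t := Ordinal (lt t).
have f_inj : injective f by move=> t t' /(congr1 val) /= /addnI /val_inj.
rewrite -[RHS]card_ord -(card_imset _ f_inj); apply: eq_card => i.
rewrite inE; apply/idP/imsetP => [/andP[ji ij]|[t _ ->]]; last first.
  by rewrite /= leq_addr ltn_add2l ltn_ord.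
have ti : (i - j * block_size n < block_size n)%N by rewrite ltn_subLR.
by exists (Ordinal ti) => //; apply: val_inj; rewrite /= subnKC.
Qed.

Lemma disjoint_sparse_support n (j j' i : 'I_n) :
  (j < num_sparse n)%N -> (j' < num_sparse n)%N ->
  i \in tnth (sparse_support n) j -> i \in tnth (sparse_support n) j' -> j = j'.
Proof.
move=> jm jm'; rewrite !tnth_mktuple jm jm' !inE => ij ij'; apply: val_inj => /=.
move: ij ij'; move: (block_size n); nia.
Qed.

Lemma full_sparse_support n (j : 'I_n) :
  (num_sparse n <= j)%N -> tnth (sparse_support n) j = [set: 'I_n]%SET.
Proof. by rewrite tnth_mktuple leqNgt => /negPf ->. Qed.

End SupportChoice.

(** [haar_estimate] for a size n that is not syntactically a sum: substituting m + (n - m) for a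
    variable n avoids casts on matrices. *)
Lemma haar_estimate_blocks (R : realType) d (T : measurableType d) (P : probability T R)
    p n m k e (Sigma : n.-tuple {set 'I_n}) (X : T -> 'M[padic p]_n) (H : finZmodType) :
  prime p -> (m <= n)%N -> haar_matrix_on P Sigma X -> 
  (forall j : 'I_n, (j < m)%N -> #|tnth Sigma j| = k) ->
  (forall j j' i : 'I_n, (j < m)%N -> (j' < m)%N ->
     i \in tnth Sigma j -> i \in tnth Sigma j' -> j = j') ->
  (forall j : 'I_n, (m <= j)%N -> tnth Sigma j = [set: 'I_n]%SET) ->
  #|H| = (p ^ e)%N ->
  exists x : R, P [set w | zmod_isog (cok (X w)) H] = x%:E /\
  `|x - #|Aut [set: H]%SET|%:R^-1 * euler_prod R p (n - m)| <=
    m%:R / p%:R ^+ k + #|{group H}|%:R / 2 ^+ (n - m).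
Proof.
move=> p_pr mn haarX cS dS fS cH; have nE : n = (m + (n - m))%N by rewrite subnKC.
move: {mn} (n - m)%N nE => N nE; subst n.
apply: (haar_estimate p_pr haarX _ _ _ cH) => [j j' i ij ij'|j|j].
- by apply: (@lshift_inj _ N); apply: (dS _ _ i) => //=.
- by apply: cS; rewrite /= ltn_ord.
- by apply: fS; rewrite /= leq_addr.
Qed.

(** * The two limits *)

Theorem theorem6p1 (R : realType) (p : nat) (eps : R) :
  prime p -> 0 < eps < 1 - p%:R^-1 ->
  exists Sigma : forall n : nat, n.-tuple {set 'I_n},
    (forall (d : nat -> measure_display) (T : forall n, measurableType (d n))
        (P : forall n, probability (T n) R)
        (X : forall n, T n -> 'M[padic p]_n),
      (forall n, haar_matrix_on (P n) (Sigma n) (X n)) ->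
      cok_converges_to_CL P X) /\
    (forall (d : nat -> measure_display) (T : forall n, measurableType (d n))
        (P : forall n, probability (T n) R)
        (Y : forall n, T n -> 'M[padic p]_n),
      (forall n, bernoulli_matrix_on (P n) (Sigma n) eps (Y n)) ->
      ~ cok_converges_to_CL P Y).
Proof.
move=> p_pr eps_bounds; pose a := 1 - eps.
have a_bounds : p%:R^-1 < a < 1 by rewrite /a; lra.
have pV0 : 0 < p%:R^-1 :> R by rewrite invr_gt0 ltr0n prime_gt0.
pose b : R := (a + p%:R^-1) / 2.
have b0 : 0 < b by rewrite /b; lra.
have a0 : 0 < a by lra.
pose m := num_sparse p a; pose k := block_size p a.
have cvg_pow (z : R) : 0 <= z < 1 -> z ^+ k n @[n --> \oo] --> (0 : R).
  move=> /andP[z0 z1].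
  apply: (@cvg_comp _ _ _ k (GRing.exp z) \oo \oo); first exact: cvg_block_size.
  by apply: cvg_expr; rewrite ger0_norm.
have csp n (j : 'I_n) : (j < m n)%N -> #|tnth (sparse_support p a n) j| = k n.
  by apply: card_sparse_support.
have dsp n (j j' i : 'I_n) : (j < m n)%N -> (j' < m n)%N ->
    i \in tnth (sparse_support p a n) j -> i \in tnth (sparse_support p a n) j' -> j = j'.
  by apply: disjoint_sparse_support.
have fsp n (j : 'I_n) : (m n <= j)%N -> tnth (sparse_support p a n) j = [set: 'I_n]%SET.
  by apply: full_sparse_support.
have kinv (z : R) : 1 < z -> 0 <= z^-1 < 1.
  by move=> z1; have z0 := lt_trans ltr01 z1; rewrite invr_ge0 invf_lt1 // z1 ltW.
exists (sparse_support p a); split=> d T P Z hZ.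
  move=> H /p_natP[e]; rewrite cardsT => cH.
  pose G : R := #|{group H}|%:R.
  pose w : R := #|Aut [set: H]%SET|%:R^-1.
  (* This dominates the error in [haar_estimate_blocks]: m p^-k by [sparse_cols_pow_p], and 2^-(n-m)
     by 2^-k because at least k columns are dense. *)
  pose D n : R := (b^-1 / p%:R) ^+ k n + p%:R^-1 ^+ k n + G * 2^-1 ^+ k n.
  have cvgD0 : D n @[n --> \oo] --> (0 : R).
    rewrite -[X in _ --> X](_ : 0 + 0 + G * 0 = 0); last by rewrite mulr0 !addr0.
    apply: cvgD; first apply: cvgD; last apply: cvgMl_tmp.
    - by apply: cvg_pow; rewrite -invfM; apply: kinv;
      rewrite -ltr_pdivrMr ?ltr0n ?prime_gt0 // mul1r /b; lra.
    - by apply: cvg_pow; apply: kinv; rewrite ltr1n prime_gt1.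
    - by apply: cvg_pow; apply: kinv; rewrite ltr1n.
  have cvgc : w * euler_prod R p (n - m n)%N @[n --> \oo] --> CL_prob R p H.
    apply: cvgMl_tmp; apply: (@cvg_comp _ _ _ (fun n => n - m n)%N (euler_prod R p) \oo \oo).
      exact: cvg_dense.
    exact: cvg_euler_prod.
  apply: (@squeeze_cvge _ _ _ _ (fun n => (w * euler_prod R p (n - m n) - D n)%:E) _
    (fun n => (w * euler_prod R p (n - m n) + D n)%:E)).
  - apply: nearW => n.
    have mn : (m n <= n)%N by apply: num_sparse_le.
    have [x [-> ]] := haar_estimate_blocks p_pr mn (hZ n) (csp n) (dsp n) (fsp n) cH.
    rewrite !lee_fin -ler_distl => /le_trans; apply.
    apply: lerD; first exact: (sparse_cols_pow_p p_pr a_bounds).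
    rewrite ler_wpM2l // exprVn lef_pV2 ?posrE ?exprn_gt0 // ler_weXn2l // ?ler1n //.
    exact: block_size_le_dense.
  - apply: cvg_EFin; first exact: nearW.
    rewrite -[CL_prob R p H]subr0; exact: cvgB.
  - apply: cvg_EFin; first exact: nearW.
    rewrite -[CL_prob R p H]addr0; exact: cvgD.
(* The trivial group refutes convergence: its probability tends to 0, while its Cohen-Lenstra mass
   is positive. *)
move=> /(_ 'I_1) cvgCL.
have {}cvgCL : P n [set w | zmod_isog (cok (Z n w)) 'I_1]
    @[n --> \oo] --> (CL_prob R p 'I_1)%:E.
  by apply: cvgCL; rewrite /pgroup cardsT card_ord.
have cvg0 : P n [set w | zmod_isog (cok (Z n w)) 'I_1] @[n --> \oo] --> (0 : R)%:E.
  apply: (@squeeze_cvge _ _ _ _ (fun=> 0%E) _ (fun n => ((b / a) ^+ k n)%:E)).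
  - apply: nearW => n; rewrite measure_ge0 /=.
    have mn : (m n <= n)%N by apply: num_sparse_le.
    (* All sparse columns; a trivial cokernel requires each of them to be nonzero. *)
    pose A := [seq widen_ord mn j | j <- enum 'I_(m n)].
    have uA : uniq A.
      by rewrite map_inj_uniq ?enum_uniq // => j j' [] /val_inj.
    have sA : size A = m n by rewrite size_map size_enum_ord.
    apply: le_trans (prob_trivial_cok p_pr (hZ n) uA (k := k n) _) _.
      by move=> _ /mapP[j _ ->]; apply: csp; rewrite /= ltn_ord.
    rewrite lee_fin sA; exact: sparse_cols_pow_a.
  - exact: cvg_cst.
  - apply: cvg_EFin; first exact: nearW.
    by apply: cvg_pow; rewrite divr_ge0 ?ltW //= ltr_pdivrMr // mul1r /b; lra.
have E : (CL_prob R p 'I_1)%:E = (0 : R)%:E.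
  exact: (@cvg_unique _ (@ereal_hausdorff R) _ _ _ _ cvgCL cvg0).
move: E => [] /eqP; apply/negP.
rewrite mulf_neq0 ?gt_eqF ?lim_euler_prod_gt0 //.
by rewrite invr_gt0 ltr0n cardG_gt0.
Qed.
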